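(* Let $\Sigma$ be a logical signature. For any $\Sigma$-H-structure $M$ in a Heyting category $\mathbb C$, the pair $\mathrm{LD}(M)=\langle\mathbb D,N\rangle$ associated with $M$ is a logically distributive category.
   Context: **Syntax.** A logical signature $\Sigma=\langle S,F,R\rangle$ consists of sorts, function symbols $f\colon s_1\times\cdots\times s_n\to s_0$ and relation symbols $r\colon s_1\times\cdots\times s_n$; each sort $s$ has a denumerable set $V_s$ of variables. $\mathrm{LTerms}(\Sigma)$ is the set of sorted first-order terms $t:s$. Logical formulae are generated by $\top$, $\bot$, $r(t_1,\dots,t_n)$, $\wedge,\vee,\supset$, $\forall x{:}s.\,A$, $\exists x{:}s.\,A$; $\mathrm{FV}$ denotes free variables; substitution is capture-avoiding and formulae are taken up to renaming of bound variables. Formulae are identified with $\lambda$-types via $\bot=0$, $\top=1$, $\wedge=\times$, $\vee=+$, $\supset\,=\,\to$; $\lambda\mathrm{Types}(\Sigma)$ is the set of these. **Heyting semantics.** A Heyting category $\mathbb C$ is a coherent category (regular, with finite joins of sub-objects stable under pullback) in which every pullback functor $f^*\colon\mathrm{Sub}_{\mathbb C}(b)\to\mathrm{Sub}_{\mathbb C}(a)$, $f\colon a\to b$, has a right adjoint $\forall_f$; it always has a left adjoint $\exists_f$, and each $\mathrm{Sub}_{\mathbb C}(a)$ is (up to isomorphisms) a Heyting algebra. A $\Sigma$-H-structure $M$ in $\mathbb C$ assigns to each sort $A$ an object $MA$, to each function symbol $f\colon A_1\times\cdots\times A_n\to B$ an arrow $Mf\colon MA_1\times\cdots\times MA_n\to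 MB$, and to each relation symbol $R\colon A_1\times\cdots\times A_n$ a sub-object $MR\rightarrowtail MA_1\times\cdots\times MA_n$. For a context $\vec x=x_1:A_1,\dots,x_n:A_n$ put $M\vec x=MA_1\times\cdots\times MA_n$ (terminal object if $\vec x$ is empty). Terms in context: $[\![\vec x.\,x_i]\!]=\pi_i$, $[\![\vec x.\,f(t_1,\dots,t_m)]\!]=Mf\circ([\![\vec x.\,t_1]\!],\dots,[\![\vec x.\,t_m]\!])$. Formulae in context are interpreted as sub-objects $[\![\vec x.\phi]\!]$ of $M\vec x$: $[\![\vec x.\,R(t_1,\dots,t_m)]\!]$ is the pullback of $MR$ along $([\![\vec x.\,t_1]\!],\dots,[\![\vec x.\,t_m]\!])$; $\top,\bot,\wedge,\vee,\supset$ are interpreted by the corresponding Heyting algebra operations of $\mathrm{Sub}_{\mathbb C}(M\vec x)$; $[\![\vec x.\,\exists y{:}s.\,\psi]\!]=\exists_\pi[\![\vec x,y:s.\,\psi]\!]$ and $[\![\vec x.\,\forall y{:}s.\,\psi]\!]=\forall_\pi[\![\vec x,y:s.\,\psi]\!]$ with $\pi\colon M\vec x\times Ms\to M\vec x$ the projection. **The pair $\mathrm{LD}(M)=\langle\mathbb D,N\rangle$.** The objects of $\mathbb D$ are $[\![\mathrm{FV}(\phi).\phi]\!]_{\mathbb C}$ for every logical formula $\phi$ over $\Sigma$; $\mathrm{Hom}_{\mathbb D}([\![\mathrm{FV}(\phi).\phi]\!],[\![\mathrm{FV}(\psi).\psi]\!])$ contains at most one arrow, and it contains one exactly when $[\![\mathrm{FV}(\phi)\cup\mathrm{FV}(\psi).\phi]\!]\le[\![\mathrm{FV}(\phi)\cup\mathrm{FV}(\psi).\psi]\!]$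 in $\mathrm{Sub}_{\mathbb C}(M(\mathrm{FV}(\phi)\cup\mathrm{FV}(\psi)))$; identities and composition come from reflexivity and transitivity of $\le$; $N$ maps each $\phi$ to $[\![\mathrm{FV}(\phi).\phi]\!]$. **Logically distributive category.** A category $\mathbb D$ with a map $N\colon\lambda\mathrm{Types}(\Sigma)\to\mathrm{Obj}\,\mathbb D$ is logically distributive if: (1)–(3) $\mathbb D$ has finite products, finite co-products and exponentiation; (4) each $\Delta=[1_A\times\iota_1,1_A\times\iota_2]\colon(A\times B)+(A\times C)\to A\times(B+C)$ has an inverse. For a sort $s$, type $A$, $x\in V_s$, let $\Sigma_A(x{:}s)$ be the functor from the discrete category on $\{t:s\in\mathrm{LTerms}(\Sigma)\}$ to $\mathbb D$ with $t:s\mapsto N(A[t/x])$. Let $\mathbb D_{\forall x:s.A}$ be the subcategory of $\mathbb D$ whose objects are the vertexes of cones on $\Sigma_A(x{:}s)$ of the form $NB$ with $x:s\notin\mathrm{FV}(B)$ and whose arrows, apart from identities, are the arrows in the category of cones over $\Sigma_A(x{:}s)$ from these objects to $N(\forall x{:}s.\,A)$. Dually, $\mathbb D_{\exists x:s.A}$ has as objects the vertexes of co-cones on $\Sigma_A(x{:}s)$ of the form $NB$ with $x:s\notin\mathrm{FV}(B)$, and as arrows, apart from identities, the arrows in the category of co-cones from $N(\exists x{:}s.\,A)$ to these objects. (5) All $\mathbb D_{\forall x:s.A}$ have terminal objects and all $\mathbb D_{\exists x:s.A}$ have initial objects; (6) $N0=0$ (initial), $N1=1$ (terminal), $N(A\times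 B)=NA\times NB$, $N(A+B)=NA+NB$, $N(A\to B)=NB^{NA}$, $N(\forall x{:}s.\,A)$ is terminal in $\mathbb D_{\forall x:s.A}$, $N(\exists x{:}s.\,A)$ is initial in $\mathbb D_{\exists x:s.A}$; (7) if $x:s\notin\mathrm{FV}(A)$, the unique arrow $N(\exists x{:}s.\,A\times B)\to NA\times N(\exists x{:}s.\,B)$ in $\mathbb D_{\exists x:s.A\times B}$ has an inverse.
   Formalization: Adds the hypothesis that for every sort s the arrow Ms → 1 is a regular epimorphism; without it the claim fails (e.g. in Set with Ms empty, ⊤ ≤ ∃x:s.⊤ fails), and the conclusion implies it. Sorts are assumed to have decidable equality. *)

(* Defs.v *)
From mathcomp Require Import all_boot.
From Stdlib Require Import ProofIrrelevance.

Set Implicit Arguments.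
Unset Strict Implicit.
Unset Printing Implicit Defensive.

Declare Scope cat_scope.
Delimit Scope cat_scope with cat.
Local Open Scope cat_scope.

Record category_on (O : Type) (H : O -> O -> Type) := CategoryOn {
  idm_on : forall a, H a a;
  comp_on : forall a b c, H b c -> H a b -> H a c;
  comp_on1m : forall a b (f : H a b), comp_on (idm_on b) f = f;
  comp_onm1 : forall a b (f : H a b), comp_on f (idm_on a) = f;
  comp_onA : forall a b c d (h : H c d) (g : H b c) (f : H a b),
    comp_on h (comp_on g f) = comp_on (comp_on h g) f
}.

Record category := Category {
  ob :> Type;
  hom : ob -> ob -> Type;
  cat_on : category_on hom
}.
Arguments hom {c} _ _.

Definition idm (C : category) (a : C) : hom a a := idm_on (cat_on C) a.
Definition comp (C : category) (a b c : C) (g : hom b c) (f : hom a b) :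
  hom a c := comp_on (cat_on C) g f.
Arguments idm {C} a.
Notation "g ∘ f" := (comp g f) (at level 40, left associativity) : cat_scope.

Lemma comp1m (C : category) (a b : C) (f : hom a b) : idm b ∘ f = f.
Proof. exact: comp_on1m. Qed.
Lemma compm1 (C : category) (a b : C) (f : hom a b) : f ∘ idm a = f.
Proof. exact: comp_onm1. Qed.
Lemma compA (C : category) (a b c d : C)
  (h : hom c d) (g : hom b c) (f : hom a b) : h ∘ (g ∘ f) = h ∘ g ∘ f.
Proof. exact: comp_onA. Qed.

Definition eq_hom (C : category) (a b : C) (e : a = b) : hom a b :=
  match e in _ = z return hom a z with erefl => idm a end.

Definition is_iso (C : category) (a b : C) (f : hom a b) : Prop :=
  exists g : hom b a, g ∘ f = idm a /\ f ∘ g = idm b.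

Definition is_terminal (C : category) (t : C) : Prop :=
  forall a, exists f : hom a t, forall g : hom a t, g = f.

Definition is_initial (C : category) (i : C) : Prop :=
  forall a, exists f : hom i a, forall g : hom i a, g = f.

Record finite_products (C : category) := FiniteProducts {
  one : C;
  bang : forall a, hom a one;
  bang_uniq : forall a (f : hom a one), f = bang a;
  bprod : C -> C -> C;
  pr1 : forall a b, hom (bprod a b) a;
  pr2 : forall a b, hom (bprod a b) b;
  pairing : forall c a b, hom c a -> hom c b -> hom c (bprod a b);
  pr1_pair : forall c a b (f : hom c a) (g : hom c b),
    pr1 a b ∘ pairing f g = f;
  pr2_pair : forall c a b (f : hom c a) (g : hom c b),
    pr2 a b ∘ pairing f g = g;
  pair_uniq : forall c a b (h : hom c (bprod a b)),
    h = pairing (pr1 a b ∘ h) (pr2 a b ∘ h)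
}.

Record finite_coproducts (C : category) := FiniteCoproducts {
  zero : C;
  cobang : forall a, hom zero a;
  cobang_uniq : forall a (f : hom zero a), f = cobang a;
  coprod : C -> C -> C;
  in1 : forall a b, hom a (coprod a b);
  in2 : forall a b, hom b (coprod a b);
  copair : forall c a b, hom a c -> hom b c -> hom (coprod a b) c;
  copair_in1 : forall c a b (f : hom a c) (g : hom b c),
    copair f g ∘ in1 a b = f;
  copair_in2 : forall c a b (f : hom a c) (g : hom b c),
    copair f g ∘ in2 a b = g;
  copair_uniq : forall c a b (h : hom (coprod a b) c),
    h = copair (h ∘ in1 a b) (h ∘ in2 a b)
}.

Definition prod_map (C : category) (P : finite_products C) (a b c d : C)
    (f : hom a c) (g : hom b d) : hom (bprod P a b) (bprod P c d) :=
  pairing P (f ∘ pr1 P a b) (g ∘ pr2 P a b).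

(* [expo b a] is the object b^a. *)
Record exponentials (C : category) (P : finite_products C) := Exponentials {
  expo : C -> C -> C;
  eval : forall b a, hom (bprod P (expo b a) a) b;
  curry : forall c b a, hom (bprod P c a) b -> hom c (expo b a);
  eval_curry : forall c b a (g : hom (bprod P c a) b),
    eval b a ∘ prod_map P (curry g) (idm a) = g;
  curry_uniq : forall c b a (h : hom c (expo b a)),
    h = curry (eval b a ∘ prod_map P h (idm a))
}.

Definition is_mono (C : category) (a b : C) (m : hom a b) : Prop :=
  forall c (f g : hom c a), m ∘ f = m ∘ g -> f = g.

Definition is_pullback (C : category) (a b c p : C) (f : hom a c) (g : hom b c)
    (p1 : hom p a) (p2 : hom p b) : Prop :=
  f ∘ p1 = g ∘ p2 /\
  forall d (h : hom d a) (k : hom d b), f ∘ h = g ∘ k ->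
    exists! u : hom d p, p1 ∘ u = h /\ p2 ∘ u = k.

Definition regular_epi (C : category) (a b : C) (e : hom a b) : Prop :=
  exists (c : C) (f g : hom c a), e ∘ f = e ∘ g /\
    forall d (h : hom a d), h ∘ f = h ∘ g -> exists! k : hom b d, k ∘ e = h.

(* Subobjects are represented by monomorphisms; two of them stand for the same
   subobject when they are equivalent in the sense of [sub_eq]. *)
Record sub (C : category) (b : C) := Sub {
  sdom : C;
  sarr : hom sdom b;
  smono : is_mono sarr
}.

Definition sub_le (C : category) (b : C) (m n : sub b) : Prop :=
  exists f : hom (sdom m) (sdom n), sarr n ∘ f = sarr m.

Definition sub_eq (C : category) (b : C) (m n : sub b) : Prop :=
  sub_le m n /\ sub_le n m.

Record pullbacks (C : category) := Pullbacks {
  pb : forall a b c : C, hom a c -> hom b c -> C;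
  pb1 : forall (a b c : C) (f : hom a c) (g : hom b c), hom (pb f g) a;
  pb2 : forall (a b c : C) (f : hom a c) (g : hom b c), hom (pb f g) b;
  pbP : forall (a b c : C) (f : hom a c) (g : hom b c),
    is_pullback f g (pb1 f g) (pb2 f g)
}.

Lemma pb1_mono (C : category) (L : pullbacks C) (a b c : C) (f : hom a c)
  (m : hom b c) : is_mono m -> is_mono (pb1 L f m).
Proof.
move=> mm d u v uv; have [e up] := pbP L f m.
have uv2 : pb2 L f m ∘ u = pb2 L f m ∘ v.
  by apply: mm; rewrite !compA -!e -!compA uv.
have [|w [_ w_uniq]] := up d (pb1 L f m ∘ u) (pb2 L f m ∘ u).
  by rewrite !compA e.
by rewrite -(w_uniq u) // -(w_uniq v).
Qed.

Definition sub_pb (C : category) (L : pullbacks C) (a b : C) (f : hom a b)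
  (m : sub b) : sub a := Sub (pb1_mono (L := L) (f := f) (@smono _ _ m)).

Lemma idm_mono (C : category) (a : C) : is_mono (idm a).
Proof. by move=> c f g; rewrite !comp1m. Qed.

Lemma comp_mono (C : category) (a b c : C) (m : hom b c) (n : hom a b) :
  is_mono m -> is_mono n -> is_mono (m ∘ n).
Proof. by move=> mm nm d f g; rewrite -!compA => /mm /nm. Qed.

Definition sub_top (C : category) (a : C) : sub a := Sub (@idm_mono C a).

Definition sub_meet (C : category) (L : pullbacks C) (a : C) (m n : sub a) :
  sub a := Sub (comp_mono (@smono _ _ m) (@smono _ _ (sub_pb L (sarr m) n))).

Record regular_category := RegularCategory {
  reg_cat :> category;
  reg_prod : finite_products reg_cat;
  reg_pb : pullbacks reg_cat;
  im : forall a b : reg_cat, hom a b -> sub b;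
  im_epi : forall (a b : reg_cat) (f : hom a b), hom a (sdom (im f));
  im_fact : forall (a b : reg_cat) (f : hom a b),
    sarr (im f) ∘ im_epi f = f;
  im_epi_regular : forall (a b : reg_cat) (f : hom a b),
    regular_epi (im_epi f);
  regular_epi_stable : forall (a b c p : reg_cat) (f : hom a c) (g : hom b c)
    (p1 : hom p a) (p2 : hom p b),
    is_pullback f g p1 p2 -> regular_epi f -> regular_epi p2
}.

Record coherent_category := CoherentCategory {
  coh_reg :> regular_category;
  sub_bot : forall a : coh_reg, sub a;
  sub_botP : forall (a : coh_reg) (m : sub a), sub_le (sub_bot a) m;
  sub_join : forall a : coh_reg, sub a -> sub a -> sub a;
  sub_joinP : forall (a : coh_reg) (m n k : sub a),
    sub_le (sub_join m n) k <-> sub_le m k /\ sub_le n k;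
  sub_pb_bot : forall (a b : coh_reg) (f : hom a b),
    sub_eq (sub_pb (reg_pb coh_reg) f (sub_bot b)) (sub_bot a);
  sub_pb_join : forall (a b : coh_reg) (f : hom a b) (m n : sub b),
    sub_eq (sub_pb (reg_pb coh_reg) f (sub_join m n))
      (sub_join (sub_pb (reg_pb coh_reg) f m) (sub_pb (reg_pb coh_reg) f n))
}.

Record heyting_category := HeytingCategory {
  hey_coh :> coherent_category;
  sub_all : forall a b : hey_coh, hom a b -> sub a -> sub b;
  sub_allP : forall (a b : hey_coh) (f : hom a b) (m : sub a) (n : sub b),
    sub_le n (sub_all f m) <-> sub_le (sub_pb (reg_pb hey_coh) f n) m
}.

Definition sub_ex (C : regular_category) (a b : C) (f : hom a b) (m : sub a) :
  sub b := im (f ∘ sarr m).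

Definition sub_imp (C : heyting_category) (a : C) (m n : sub a) : sub a :=
  sub_all (sarr m) (sub_pb (reg_pb C) (sarr m) n).

Lemma sub_le_pb (C : category) (L : pullbacks C) (a b : C) (f : hom a b)
  (m : sub a) (n : sub b) :
  sub_le m (sub_pb L f n) <->
  exists v : hom (sdom m) (sdom n), sarr n ∘ v = f ∘ sarr m.
Proof.
have [e up] := pbP L f (sarr n); split=> [[u /= um]|[v vm]].
  by exists (pb2 L f (sarr n) ∘ u); rewrite compA -e -compA um.
by have [u [[u1 _] _]] := up _ (sarr m) v (esym vm); exists u.
Qed.

Lemma sub_exP (C : regular_category) (a b : C) (f : hom a b) (m : sub a)
  (n : sub b) :
  sub_le (sub_ex f m) n <-> sub_le m (sub_pb (reg_pb C) f n).
Proof.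
apply: iff_sym; apply: iff_trans (sub_le_pb _ _ _ _) _.
split=> [[v vm]|[u um]]; last first.
  exists (u ∘ im_epi (f ∘ sarr m)).
  by rewrite compA um im_fact.
have [c [p [q [pq up]]]] := im_epi_regular (f ∘ sarr m).
have epi d (h k : hom (sdom (im (f ∘ sarr m))) d) :
    h ∘ im_epi (f ∘ sarr m) = k ∘ im_epi (f ∘ sarr m) -> h = k.
  move=> hk; have [|w [_ w_uniq]] := up _ (k ∘ im_epi (f ∘ sarr m)).
    by rewrite -!compA pq.
  by rewrite -(w_uniq h) // -(w_uniq k).
have [|k [kv _]] := up _ v.
  apply: (@smono _ _ n).
  by rewrite !compA vm -(im_fact (f ∘ sarr m)) -!compA pq.
by exists k; apply: epi; rewrite -compA kv im_fact.
Qed.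

Lemma sub_meetP (C : category) (L : pullbacks C) (a : C) (k m n : sub a) :
  sub_le k (sub_meet L m n) <-> sub_le k m /\ sub_le k n.
Proof.
have [e up] := pbP L (sarr m) (sarr n).
split=> [[u /= uk]|[[u uk] [v vk]]].
  split; first by exists (pb1 L (sarr m) (sarr n) ∘ u); rewrite compA.
  by exists (pb2 L (sarr m) (sarr n) ∘ u); rewrite compA -e.
have [|w [[w1 _] _]] := up _ u v; first by rewrite uk vk.
by exists w; rewrite /= -compA w1.
Qed.

Lemma sub_impP (C : heyting_category) (a : C) (k m n : sub a) :
  sub_le k (sub_imp m n) <-> sub_le (sub_meet (reg_pb C) k m) n.
Proof.
have [e up] := pbP (reg_pb C) (sarr m) (sarr k).
have [e' up'] := pbP (reg_pb C) (sarr k) (sarr m).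
apply: iff_trans (sub_allP _ _ _) _; apply: iff_trans (sub_le_pb _ _ _ _) _.
split=> [[v /= vm]|[v /= vk]].
  have [u [[u1 u2] _]] := up _ _ _ (esym e').
  by exists (v ∘ u); rewrite /= compA vm -compA u1 e'.
have [u [[u1 u2] _]] := up' _ _ _ (esym e).
by exists (v ∘ u); rewrite compA vk -compA u1 e.
Qed.

(* The set V_s of variables of sort s is a copy of nat: the n-th variable of
   sort s is the pair (s, n). *)
Record signature := Signature {
  srt : eqType;
  fsym : Type;
  fdom : fsym -> seq srt;
  fcod : fsym -> srt;
  rsym : Type;
  rdom : rsym -> seq srt
}.

Definition var (S : signature) : eqType := (srt S * nat)%type.

Inductive member (T : Type) : seq T -> T -> Type :=
| mhead s l : member (s :: l) s
| mtail s s' l : member l s -> member (s' :: l) s.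
Arguments mhead {T} s l.
Arguments mtail {T s} s' {l} i.

(* Free variables are named, bound variables are typed de Bruijn indices into
   the list of sorts of the enclosing binders. Hence Leibniz equality of
   formulae is equality up to renaming of bound variables. *)
Inductive term (S : signature) (D : seq (srt S)) : srt S -> Type :=
| fvar (x : var S) : term D x.1
| bvar s (i : member D s) : term D s
| app (f : fsym S) (ts : terms D (fdom f)) : term D (fcod f)
with terms (S : signature) (D : seq (srt S)) : seq (srt S) -> Type :=
| tnil : terms D [::]
| tcons s l (t : term D s) (ts : terms D l) : terms D (s :: l).
Arguments tnil {S D}.

Inductive form (S : signature) (D : seq (srt S)) : Type :=
| Top
| Bot
| Rel (r : rsym S) (ts : terms D (rdom r))
| And (A B : form D)
| Or (A B : form D)
| Imp (A B : form D)
| All (s : srt S) (A : form (s :: D))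
| Ex (s : srt S) (A : form (s :: D)).
Arguments Top {S D}.
Arguments Bot {S D}.

(* LTerms and logical formulae (= lambda-types, with 0, 1, *, +, -> written
   Bot, Top, And, Or, Imp) have no dangling bound variable. *)
Notation lterm S s := (@term S [::] s).
Notation ltype S := (@form S [::]).

(* Union of finite sets of variables, as duplicate-free lists. *)
Definition cup (T : eqType) (a b : seq T) : seq T := undup (a ++ b).

Fixpoint tFV (S : signature) (D : seq (srt S)) s (t : term D s) :
    seq (var S) :=
  match t with
  | fvar x => [:: x]
  | bvar _ _ => [::]
  | app _ ts => tsFV ts
  end
with tsFV (S : signature) (D : seq (srt S)) l (ts : terms D l) :
    seq (var S) :=
  match ts with
  | tnil => [::]
  | tcons _ _ t ts => cup (tFV t) (tsFV ts)
  end.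

Fixpoint FV (S : signature) (D : seq (srt S)) (A : form D) : seq (var S) :=
  match A with
  | Top | Bot => [::]
  | Rel _ ts => tsFV ts
  | And A B | Or A B | Imp A B => cup (FV A) (FV B)
  | All _ A | Ex _ A => FV A
  end.

(* Simultaneous substitution of terms for free variables and for bound
   indices. *)
Fixpoint tsubst (S : signature) (D D' : seq (srt S))
    (sf : forall x : var S, term D' x.1)
    (sb : forall s, member D s -> term D' s) s (t : term D s) : term D' s :=
  match t with
  | fvar x => sf x
  | bvar _ i => sb _ i
  | app _ ts => app (tssubst sf sb ts)
  end
with tssubst (S : signature) (D D' : seq (srt S))
    (sf : forall x : var S, term D' x.1)
    (sb : forall s, member D s -> term D' s) l (ts : terms D l) : terms D' l :=
  match ts with
  | tnil => tnil
  | tcons _ _ t ts => tcons (tsubst sf sb t) (tssubst sf sb ts)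
  end.

Definition tshift (S : signature) (D : seq (srt S)) r s (t : term D s) :
    term (r :: D) s :=
  tsubst (fun x => fvar (r :: D) x) (fun _ i => bvar (mtail r i)) t.

Definition up (S : signature) (D D' : seq (srt S)) r
    (sb : forall s, member D s -> term D' s) s (i : member (r :: D) s) :
    term (r :: D') s :=
  match i in member l s return
    match l with
    | [::] => unit
    | r :: l => (forall s, member l s -> term D' s) -> term (r :: D') s
    end with
  | mhead r _ => fun _ => bvar (mhead r D')
  | mtail _ r _ j => fun sb => tshift r (sb _ j)
  end sb.

Fixpoint fsubst (S : signature) (D D' : seq (srt S))
    (sf : forall x : var S, term D' x.1)
    (sb : forall s, member D s -> term D' s) (A : form D) {struct A} : form D' :=
  match A with
  | Top => Top
  | Bot => Bot
  | Rel _ ts => Rel (tssubst sf sb ts)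
  | And A B => And (fsubst sf sb A) (fsubst sf sb B)
  | Or A B => Or (fsubst sf sb A) (fsubst sf sb B)
  | Imp A B => Imp (fsubst sf sb A) (fsubst sf sb B)
  | All s A => All (fsubst (fun x => tshift s (sf x)) (up sb) A)
  | Ex s A => Ex (fsubst (fun x => tshift s (sf x)) (up sb) A)
  end.

Definition single (S : signature) (D : seq (srt S)) (x : var S)
    (t : term D x.1) (y : var S) : term D y.1 :=
  match x =P y with
  | ReflectT e => match e in _ = z return term D z.1 with erefl => t end
  | ReflectF _ => fvar D y
  end.

(* [subst x t A] is A[t/x]. *)
Definition subst (S : signature) (x : var S) (t : lterm S x.1) (A : ltype S) :
  ltype S := fsubst (single t) (fun _ i => bvar i) A.

(* Turns the free variable x into the outermost bound variable. *)
Definition abstract (S : signature) (x : var S) (A : ltype S) :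
    form [:: x.1] :=
  fsubst (single (bvar (mhead x.1 [::])))
    (fun _ i => bvar (mtail x.1 i)) A.

Definition forallv (S : signature) (x : var S) (A : ltype S) : ltype S :=
  All (abstract x A).
Definition existsv (S : signature) (x : var S) (A : ltype S) : ltype S :=
  Ex (abstract x A).

(* The product A_1 * (A_2 * (... * 1)) of a family indexed by a list. *)
Fixpoint lprod (C : category) (P : finite_products C) (T : Type) (F : T -> C)
    (l : seq T) : C :=
  match l with
  | [::] => one P
  | s :: l => bprod P (F s) (lprod P F l)
  end.

Fixpoint lproj (C : category) (P : finite_products C) (T : Type) (F : T -> C)
    (l : seq T) (s : T) (i : member l s) : hom (lprod P F l) (F s) :=
  match i with
  | mhead s l => pr1 P (F s) (lprod P F l)
  | mtail _ r l j => lproj P F j ∘ pr2 P (F r) (lprod P F l)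
  end.

Record hstructure (S : signature) (C : heyting_category) := HStructure {
  Msort :> srt S -> C;
  Mfun : forall f : fsym S,
    hom (lprod (reg_prod C) Msort (fdom f)) (Msort (fcod f));
  Mrel : forall r : rsym S, sub (lprod (reg_prod C) Msort (rdom r))
}.

(* The interpretation of the context consisting of the bound variables D,
   innermost binder first, and of the named variables G. *)
Definition ctx (S : signature) (C : heyting_category) (M : hstructure S C)
    (D : seq (srt S)) (G : seq (var S)) : C :=
  lprod (reg_prod C) M (D ++ [seq x.1 | x <- G]).

Fixpoint bpos (T : Type) (D l : seq T) s (i : member D s) :
    member (D ++ l) s :=
  match i in member D s return member (D ++ l) s with
  | mhead s D => mhead s (D ++ l)
  | mtail _ r _ j => mtail r (bpos l j)
  end.

Fixpoint mskip (T : Type) (D l : seq T) s (i : member l s) :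
    member (D ++ l) s :=
  match D with
  | [::] => i
  | r :: D => mtail r (mskip D i)
  end.

Lemma mem_behead_neq (T : eqType) (x y : T) (G : seq T) :
  x \in y :: G -> x <> y -> x \in G.
Proof. by rewrite inE => /predU1P[]. Qed.

Fixpoint fpos (S : signature) (x : var S) (G : seq (var S)) :
    x \in G -> member [seq y.1 | y <- G] x.1 :=
  match G with
  | [::] => fun h => False_rect _ (notF h)
  | y :: G => fun h =>
    match x =P y with
    | ReflectT e =>
        match e in _ = z return member (z.1 :: [seq y.1 | y <- G]) x.1 with
        | erefl => mhead x.1 _
        end
    | ReflectF ne => mtail y.1 (fpos (mem_behead_neq h ne))
    end
  end.

Lemma cup_subl (T : eqType) (a b G : seq T) :
  {subset cup a b <= G} -> {subset a <= G}.
Proof. by move=> h x xa; apply: h; rewrite mem_undup mem_cat xa. Qed.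

Lemma cup_subr (T : eqType) (a b G : seq T) :
  {subset cup a b <= G} -> {subset b <= G}.
Proof. by move=> h x xb; apply: h; rewrite mem_undup mem_cat xb orbT. Qed.

(* Terms and formulae are only interpreted in contexts that contain their free
   variables. *)
Fixpoint tinterp (S : signature) (C : heyting_category) (M : hstructure S C)
    (D : seq (srt S)) (G : seq (var S)) s (t : term D s) :
    {subset tFV t <= G} -> hom (ctx M D G) (M s) :=
  match t with
  | fvar x => fun h => lproj (reg_prod C) M (mskip D (fpos (h x (mem_head x _))))
  | bvar _ i => fun _ => lproj (reg_prod C) M (bpos _ i)
  | app f ts => fun h => Mfun M f ∘ tsinterp M h
  end
with tsinterp (S : signature) (C : heyting_category) (M : hstructure S C)
    (D : seq (srt S)) (G : seq (var S)) l (ts : terms D l) :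
    {subset tsFV ts <= G} -> hom (ctx M D G) (lprod (reg_prod C) M l) :=
  match ts with
  | tnil => fun _ => bang (reg_prod C) (ctx M D G)
  | tcons _ _ t ts => fun h =>
      pairing (reg_prod C) (tinterp M (cup_subl h)) (tsinterp M (cup_subr h))
  end.

(* A quantified variable is put in front of the context, so that the
   projection pi is the second one. *)
Fixpoint interp (S : signature) (C : heyting_category) (M : hstructure S C)
    (G : seq (var S)) (D : seq (srt S)) (A : form D) :
    {subset FV A <= G} -> sub (ctx M D G) :=
  match A return {subset FV A <= G} -> sub (ctx M D G) with
  | Top => fun _ => sub_top _
  | Bot => fun _ => sub_bot _
  | Rel r ts => fun h => sub_pb (reg_pb C) (tsinterp M h) (Mrel M r)
  | And A B => fun h =>
      sub_meet (reg_pb C) (interp M (cup_subl h)) (interp M (cup_subr h))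
  | Or A B => fun h =>
      sub_join (interp M (cup_subl h)) (interp M (cup_subr h))
  | Imp A B => fun h =>
      sub_imp (interp M (cup_subl h)) (interp M (cup_subr h))
  | All s A => fun h =>
      sub_all (pr2 (reg_prod C) (M s) (ctx M D G)) (interp (D := s :: D) M h)
  | Ex s A => fun h =>
      sub_ex (pr2 (reg_prod C) (M s) (ctx M D G)) (interp (D := s :: D) M h)
  end.

Lemma hom_sig_eq (T : Type) (P : T -> Prop) (u v : {f : T | P f}) :
  sval u = sval v -> u = v.
Proof. exact: (@eq_sig_hprop _ P (fun _ => @proof_irrelevance _)). Qed.

(* Arrows of the form [idm (v c)], for objects [c] of a category whose objects
   have underlying objects [v c] of C. *)
Inductive id_arrow (C : category) (O : Type) (v : O -> C) :
    forall c d : O, hom (v c) (v d) -> Prop :=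
| IdArrow c : @id_arrow C O v c c (idm (v c)).
Arguments id_arrow {C O} v {c d} f.

(* The categories D_{forall x:s.A} and D_{exists x:s.A}. An object is a (co)cone
   rather than a bare vertex, since it is the (co)cone that determines which
   arrows there are. The diagram being discrete, a (co)cone is just a family of
   arrows. *)
Section Quantifiers.
Variables (S : signature) (C : category) (N : ltype S -> C).
Variables (x : var S) (A : ltype S).

Record qcone := QCone {
  qc_vertex :> C;
  qc_form : exists2 B, qc_vertex = N B & x \notin FV B;
  qc_leg : forall t : lterm S x.1, hom qc_vertex (N (subst t A))
}.

Definition qcone_arrow (c d : qcone) (f : hom c d) : Prop :=
  (forall t, qc_leg d t ∘ f = qc_leg c t) /\
  (qc_vertex d = N (forallv x A) \/ id_arrow qc_vertex f).

Definition qcone_hom (c d : qcone) : Type := {f : hom c d | qcone_arrow f}.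

Lemma qcone_idP (c : qcone) : qcone_arrow (idm c).
Proof. by split=> [t|]; [rewrite compm1|right]. Qed.

Lemma qcone_compP (c d e : qcone) (g : hom d e) (f : hom c d) :
  qcone_arrow g -> qcone_arrow f -> qcone_arrow (g ∘ f).
Proof.
move=> [gl gi] [fl fi]; split=> [t|]; first by rewrite compA gl fl.
case: gi => [|gi]; first by left.
case: gi f fl fi => {g gl e} {}d f _.
by rewrite comp1m.
Qed.

Definition qcone_id (c : qcone) : qcone_hom c c := exist _ _ (qcone_idP c).

Definition qcone_comp (c d e : qcone) (g : qcone_hom d e)
  (f : qcone_hom c d) : qcone_hom c e :=
  exist _ _ (qcone_compP (proj2_sig g) (proj2_sig f)).

Definition qcone_cat_on : category_on qcone_hom.
Proof.
apply: (@CategoryOn _ _ qcone_id qcone_comp).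
- by move=> a b f; apply: hom_sig_eq; rewrite /= comp1m.
- by move=> a b f; apply: hom_sig_eq; rewrite /= compm1.
- by move=> a b c d h g f; apply: hom_sig_eq; rewrite /= compA.
Defined.

Definition forall_cat : category := Category qcone_cat_on.

Record qcocone := QCocone {
  qcc_vertex :> C;
  qcc_form : exists2 B, qcc_vertex = N B & x \notin FV B;
  qcc_leg : forall t : lterm S x.1, hom (N (subst t A)) qcc_vertex
}.

Definition qcocone_arrow (c d : qcocone) (f : hom c d) : Prop :=
  (forall t, f ∘ qcc_leg c t = qcc_leg d t) /\
  (qcc_vertex c = N (existsv x A) \/ id_arrow qcc_vertex f).

Definition qcocone_hom (c d : qcocone) : Type :=
  {f : hom c d | qcocone_arrow f}.

Lemma qcocone_idP (c : qcocone) : qcocone_arrow (idm c).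
Proof. by split=> [t|]; [rewrite comp1m|right]. Qed.

Lemma qcocone_compP (c d e : qcocone) (g : hom d e) (f : hom c d) :
  qcocone_arrow g -> qcocone_arrow f -> qcocone_arrow (g ∘ f).
Proof.
move=> [gl gi] [fl fi]; split=> [t|]; first by rewrite -compA fl gl.
case: fi => [|fi]; first by left.
case: fi g gl gi => {f fl c} {}d g _.
by rewrite compm1.
Qed.

Definition qcocone_id (c : qcocone) : qcocone_hom c c :=
  exist _ _ (qcocone_idP c).

Definition qcocone_comp (c d e : qcocone) (g : qcocone_hom d e)
  (f : qcocone_hom c d) : qcocone_hom c e :=
  exist _ _ (qcocone_compP (proj2_sig g) (proj2_sig f)).

Definition qcocone_cat_on : category_on qcocone_hom.
Proof.
apply: (@CategoryOn _ _ qcocone_id qcocone_comp).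
- by move=> a b f; apply: hom_sig_eq; rewrite /= comp1m.
- by move=> a b f; apply: hom_sig_eq; rewrite /= compm1.
- by move=> a b c d h g f; apply: hom_sig_eq; rewrite /= compA.
Defined.

Definition exists_cat : category := Category qcocone_cat_on.

End Quantifiers.

Definition distr_arrow (C : category) (P : finite_products C)
    (Q : finite_coproducts C) (a b c : C) :
    hom (coprod Q (bprod P a b) (bprod P a c)) (bprod P a (coprod Q b c)) :=
  copair Q (prod_map P (idm a) (in1 Q b c)) (prod_map P (idm a) (in2 Q b c)).

(* The initial co-cone over B, with vertex N(exists x.B), induces
   a co-cone over A * B with vertex NA * N(exists x.B), whose leg at t is
     N((A * B)[t/x]) = NA * N(B[t/x]) --> NA * N(exists x.B). *)
Definition exists_distr (S : signature) (C : category) (N : ltype S -> C)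
    (P : finite_products C) (x : var S) (A B : ltype S) : Prop :=
  forall (c : exists_cat N x (And A B)) (d : exists_cat N x B),
    is_initial c -> qcc_vertex c = N (existsv x (And A B)) ->
    is_initial d -> qcc_vertex d = N (existsv x B) ->
  exists (w : exists2 E, bprod P (N A) (qcc_vertex d) = N E & x \notin FV E)
    (e : forall t, N (subst t (And A B)) = bprod P (N A) (N (subst t B)))
    (f : hom c (QCocone (A := And A B) w (fun t =>
       prod_map P (idm (N A)) (qcc_leg d t) ∘ eq_hom (e t)))),
    is_iso (sval f).

Record logically_distributive_for (S : signature) (C : category)
    (N : ltype S -> C) (P : finite_products C) (Q : finite_coproducts C)
    (E : exponentials P) : Prop := {
  ld_distr : forall a b c : C, is_iso (distr_arrow P Q a b c);
  ld_Bot : N Bot = zero Q;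
  ld_Top : N Top = one P;
  ld_And : forall A B, N (And A B) = bprod P (N A) (N B);
  ld_Or : forall A B, N (Or A B) = coprod Q (N A) (N B);
  ld_Imp : forall A B, N (Imp A B) = expo E (N B) (N A);
  ld_forall : forall (x : var S) (A : ltype S),
    exists2 c : forall_cat N x A,
      is_terminal c & qc_vertex c = N (forallv x A);
  ld_exists : forall (x : var S) (A : ltype S),
    exists2 c : exists_cat N x A,
      is_initial c & qcc_vertex c = N (existsv x A);
  ld_exists_distr : forall (x : var S) (A B : ltype S),
    x \notin FV A -> exists_distr N P x A B
}.

Definition logically_distributive (S : signature) (C : category)
    (N : ltype S -> C) : Prop :=
  exists (P : finite_products C) (Q : finite_coproducts C)
    (E : exponentials P), logically_distributive_for N Q E.

Section LD.
Variables (S : signature) (C : heyting_category) (M : hstructure S C).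

(* The subobject denoted by A in context G, as an equivalence class of
   monomorphisms. *)
Definition denot (G : seq (var S)) (A : ltype S) (h : {subset FV A <= G}) :
    sub (ctx M [::] G) -> Prop :=
  fun m => sub_eq m (interp M h).

(* The object [[FV(A).A]]. The context is kept as a component: P(x) and P(y),
   for x and y of the same sort, denote the same subobject of C, but the
   hom-sets do distinguish them. *)
Definition ld_denot (A : ltype S) :
    {G : seq (var S) & sub (ctx M [::] G) -> Prop} :=
  existT _ (FV A) (denot (fun x => id)).

Definition ld_obj : Type := {o | exists A, o = ld_denot A}.

Definition ldN (A : ltype S) : ld_obj :=
  exist _ (ld_denot A) (ex_intro _ A erefl).

Lemma sub_cupl (T : eqType) (a b : seq T) : {subset a <= cup a b}.
Proof. exact: (@cup_subl _ a b). Qed.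

Lemma sub_cupr (T : eqType) (a b : seq T) : {subset b <= cup a b}.
Proof. exact: (@cup_subr _ a b). Qed.

Definition ld_le (A B : ltype S) : Prop :=
  sub_le (interp M (@sub_cupl _ (FV A) (FV B)))
    (interp M (@sub_cupr _ (FV A) (FV B))).

(* Being a proposition, [ld_hom a b] has at most one element, and there is only
   one way to make it into the hom-sets of a category. *)
Definition ld_hom (a b : ld_obj) : Prop :=
  exists A B, [/\ a = ldN A, b = ldN B & ld_le A B].

(* All sorts are interpreted by well-supported objects. This is necessary for
   LD(M) to be logically distributive: the leg of the co-cone with vertex
   N(exists x:s.Top) is an inequality Top <= [[exists x:s.Top]] in the empty
   context, which forces M s -> 1 to be a regular epimorphism. It also makes the
   hom-relation transitive when an intermediate formula has extra free
   variables. *)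
Definition well_supported : Prop :=
  forall s : srt S, regular_epi (bang (reg_prod C) (M s)).

End LD.

(* Main.v *)
From mathcomp Require Import all_boot.
From Stdlib Require Import ProofIrrelevance FunctionalExtensionality.
From Stdlib Require Import PropExtensionality IndefiniteDescription.
Require Import Defs.

(** Each hom-set of LD(M) has at most one arrow, so LD(M) is a preorder under
    entailment between formulae: every equation between arrows is free, and
    what has to be shown is that the rules of first-order intuitionistic logic
    are sound for the Heyting semantics.

    Soundness rests on [formula_substitution]: substituting terms into a
    formula amounts to pulling its interpretation back along the arrow that
    the terms denote. The induction goes through because all connectives are
    stable under pullback. For existential quantification this is the
    Beck-Chevalley condition, a consequence of the stability of regular
    epimorphisms; it passes to the universal quantifier by adjunction, and from
    there to implication, which is universal quantification along a
    monomorphism.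

    The order of LD(M) compares A and B in the context made of their own
    variables, while transitivity and the quantifier rules compare formulae in
    different contexts. Adding variables to a context is harmless, being a
    pullback. Removing one is harmless because its sort is well-supported: the
    projection is then a regular epimorphism, along which pullback reflects the
    order. So entailment is independent of the context ([ld_leE]), hence
    transitive, and the quantifiers obey the usual adjunctions
    ([ld_le_forall], [ld_le_exists]), because a bound variable and a variable at
    the front of the context are interpreted by the same projection.
    The remaining laws, in particular distributivity of conjunction over
    disjunction and over existential quantification, follow formally because
    conjunction has implication as right adjoint.

    Two formulae are the same object exactly when they have the same list of
    free variables and entail each other ([ldN_eqP]). This is a congruence for
    the connectives, so that products, coproducts and exponentials of objects
    can be computed on chosen representatives and still satisfy the equations
    such as N(A * B) = NA * NB on the nose. As for the quantifiers, a variable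
    x is a term of its sort, so a cone over the instances of A with vertex NB
    contains an arrow from NB to NA; when x is not free in B, this is all that
    is needed to reach N(forall x. A). *)

Set Implicit Arguments.
Unset Strict Implicit.
Unset Printing Implicit Defensive.

Local Open Scope cat_scope.

(** * Subobjects through their generalized elements *)

Section Elements.
Variables (C : category) (L : pullbacks C).

(** Membership of a generalized element. Pullback of subobjects becomes
    composition of elements, which makes its functoriality immediate. *)
Definition belongs (b d : C) (m : sub b) (h : hom d b) : Prop :=
  exists v, sarr m ∘ v = h.

Lemma sub_leP (b : C) (m n : sub b) :
  sub_le m n <-> forall d (h : hom d b), belongs m h -> belongs n h.
Proof.
split=> [[u um] d h [v <-]|mn].
  by exists (u ∘ v); rewrite compA um.
by apply: mn; exists (idm _); rewrite compm1.
Qed.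

Lemma belongs_pb (a b d : C) (f : hom a b) (m : sub b) (h : hom d a) :
  belongs (sub_pb L f m) h <-> belongs m (f ∘ h).
Proof.
have [e univ] := pbP L f (sarr m); split=> [[v <-]|[v vh]].
  by exists (pb2 L f (sarr m) ∘ v); rewrite !compA -e.
by have [u [[u1 _] _]] := univ _ h v (esym vh); exists u.
Qed.

Lemma belongs_meet (b d : C) (m n : sub b) (h : hom d b) :
  belongs (sub_meet L m n) h <-> belongs m h /\ belongs n h.
Proof.
split=> [[v <-]|[[v <-] nv]].
  by split; apply: (sub_leP _ _).1 (ex_intro _ v erefl);
    have [] := (sub_meetP L (sub_meet L m n) m n).1 (ex_intro _ (idm _) (compm1 _)).
have [w wv] := (belongs_pb _ _ _).2 nv.
by exists w; rewrite /= -compA wv.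
Qed.

Lemma sub_le_refl (b : C) (m : sub b) : sub_le m m.
Proof. exact/sub_leP. Qed.

Lemma sub_le_trans (b : C) (m n k : sub b) :
  sub_le m n -> sub_le n k -> sub_le m k.
Proof. by move=> /sub_leP mn /sub_leP nk; apply/sub_leP => d h /mn/nk. Qed.

Lemma sub_eq_refl (b : C) (m : sub b) : sub_eq m m.
Proof. by split; apply: sub_le_refl. Qed.

Lemma sub_eq_sym (b : C) (m n : sub b) : sub_eq m n -> sub_eq n m.
Proof. by case. Qed.

Lemma sub_eq_trans (b : C) (m n k : sub b) :
  sub_eq m n -> sub_eq n k -> sub_eq m k.
Proof.
by move=> [mn nm] [nk kn]; split;
  [apply: sub_le_trans mn nk|apply: sub_le_trans kn nm].
Qed.

Lemma sub_eqP (b : C) (m n : sub b) :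
  sub_eq m n <-> forall d (h : hom d b), belongs m h <-> belongs n h.
Proof.
split=> [[/sub_leP mn /sub_leP nm] d h|mn]; first by split; auto.
by split; apply/sub_leP => d h /mn.
Qed.

(** A subobject is determined by its lower bounds, so two right adjoints can be
    compared by chaining adjunctions. *)
Lemma sub_eq_below (b : C) (m n : sub b) :
  (forall k, sub_le k m <-> sub_le k n) -> sub_eq m n.
Proof. by move=> mn; split; apply/mn; apply: sub_le_refl. Qed.

Lemma sub_pb_le (a b : C) (f : hom a b) (m n : sub b) :
  sub_le m n -> sub_le (sub_pb L f m) (sub_pb L f n).
Proof.
by move=> /sub_leP mn; apply/sub_leP => d h /belongs_pb/mn/belongs_pb.
Qed.

Lemma sub_pb_comp (a b c : C) (f : hom a b) (g : hom b c) (m : sub c) :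
  sub_eq (sub_pb L f (sub_pb L g m)) (sub_pb L (g ∘ f) m).
Proof.
apply/sub_eqP => d h; split=> [/belongs_pb/belongs_pb|/belongs_pb] hm.
  by apply/belongs_pb; rewrite -compA.
by do 2!apply/belongs_pb; rewrite compA.
Qed.

Lemma sub_pb_id (a : C) (m : sub a) : sub_eq (sub_pb L (idm a) m) m.
Proof. by apply/sub_eqP => d h; rewrite belongs_pb comp1m. Qed.

(** Regular epimorphisms are orthogonal to monomorphisms, so membership may be
    tested after a regular epimorphic change of stage. *)
Lemma belongs_regular_epi (a b c : C) (e : hom a b) (m : sub c) (h : hom b c) :
  regular_epi e -> belongs m (h ∘ e) -> belongs m h.
Proof.
move=> [d [p [q [pq univ]]]] [v vh].
have [|k [kv _]] := univ _ v.
  by apply: (@smono _ _ m); rewrite !compA vh -!compA pq.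
exists k; have [|w [_ w_uniq]] := univ _ (h ∘ e); first by rewrite -!compA pq.
by rewrite -(w_uniq h erefl); apply/esym/w_uniq; rewrite -compA kv.
Qed.

End Elements.

Section Stability.
Variable C : heyting_category.
Notation pb := (sub_pb (reg_pb C)).

Lemma sub_pb_meet (a b : C) (f : hom a b) (m n : sub b) (m' n' : sub a) :
  sub_eq m' (pb f m) -> sub_eq n' (pb f n) ->
  sub_eq (sub_meet (reg_pb C) m' n') (pb f (sub_meet (reg_pb C) m n)).
Proof.
move=> /sub_eqP em /sub_eqP en; apply/sub_eqP => d h.
by rewrite belongs_pb !belongs_meet em en !belongs_pb.
Qed.

Lemma sub_join_le (a : C) (m n m' n' : sub a) :
  sub_le m m' -> sub_le n n' -> sub_le (sub_join m n) (sub_join m' n').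
Proof.
move=> mm nn; have [lem len] := (sub_joinP m' n' _).1 (sub_le_refl _).
by apply/sub_joinP; split;
  [apply: sub_le_trans mm lem|apply: sub_le_trans nn len].
Qed.

Lemma sub_pb_join_eq (a b : C) (f : hom a b) (m n : sub b) (m' n' : sub a) :
  sub_eq m' (pb f m) -> sub_eq n' (pb f n) ->
  sub_eq (sub_join m' n') (pb f (sub_join m n)).
Proof.
move=> [m1 m2] [n1 n2]; apply: sub_eq_trans (sub_eq_sym (sub_pb_join _ _ _)).
by split; apply: sub_join_le.
Qed.

Lemma sub_ex_le (a b : C) (f : hom a b) (m n : sub a) :
  sub_le m n -> sub_le (sub_ex f m) (sub_ex f n).
Proof.
move=> mn; apply/sub_exP; apply: sub_le_trans mn _.
exact/sub_exP/sub_le_refl.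
Qed.

Lemma sub_all_le (a b : C) (f : hom a b) (m n : sub a) :
  sub_le m n -> sub_le (sub_all f m) (sub_all f n).
Proof.
move=> mn; apply/sub_allP; apply: sub_le_trans mn.
exact/sub_allP/sub_le_refl.
Qed.

Section BeckChevalley.
Variables (a b c p : C) (f : hom a c) (g : hom b c).
Variables (p1 : hom p a) (p2 : hom p b).
Hypothesis square : is_pullback f g p1 p2.

(** Regular epimorphisms are stable, so the image factorization of the
    restriction of g to m remains one when pulled back along f. *)
Lemma sub_ex_pb (m : sub b) :
  sub_eq (sub_ex p1 (pb p2 m)) (pb f (sub_ex g m)).
Proof.
have [fg univ] := square; split.
  apply/sub_exP/sub_leP => d h /belongs_pb mh; do 2!apply/belongs_pb.
  rewrite compA fg -compA; apply/belongs_pb.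
  by apply: (sub_leP _ _).1 mh; apply/sub_exP/sub_le_refl.
set k := pb f (sub_ex g m).
(* k2 is the projection of the pullback k onto the image of m. *)
have [k2 fk] : belongs (sub_ex g m) (f ∘ sarr k).
  by apply/belongs_pb; exists (idm _); rewrite compm1.
set e := im_epi (g ∘ sarr m).
have [q [q1 [q2 sq]]] :
    exists q (q1 : hom q (sdom m)) (q2 : hom q (sdom k)), is_pullback e k2 q1 q2.
  by exists _, (pb1 (reg_pb C) e k2), (pb2 (reg_pb C) e k2); apply: pbP.
have [eq2 _] := sq.
have q2_epi := regular_epi_stable sq (im_epi_regular _).
have [|u [[u1 u2] _]] := univ _ (sarr k ∘ q2) (sarr m ∘ q1).
  by rewrite compA -fk -!compA -eq2 !compA im_fact.
have [w wk] : belongs (sub_ex p1 (pb p2 m)) (sarr k).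
  apply: (belongs_regular_epi q2_epi); rewrite -u1; apply/belongs_pb.
  apply: (sub_leP (pb p2 m) _).1; first exact/sub_exP/sub_le_refl.
  by apply/belongs_pb; rewrite u2; exists q1.
by exists w.
Qed.

End BeckChevalley.

(** Taking right adjoints turns the Beck-Chevalley condition for images into
    the one for universal quantification. *)
Lemma sub_all_pb (a b c p : C) (f : hom a c) (g : hom b c) (p1 : hom p a)
    (p2 : hom p b) (m : sub b) :
  is_pullback f g p1 p2 -> sub_eq (sub_all p1 (pb p2 m)) (pb f (sub_all g m)).
Proof.
move=> [fg univ].
have square : is_pullback g f p2 p1.
  split=> // d h k hk; have [u [[u1 u2] uu]] := univ d k h (esym hk).
  by exists u; split=> // v [v2 v1]; apply: uu.
apply: sub_eq_below => k; rewrite -sub_exP !sub_allP -sub_exP.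
have [le ge] := sub_ex_pb square k.
by split; apply: sub_le_trans.
Qed.

Lemma sub_imp_le (a : C) (m n m' n' : sub a) :
  sub_le m' m -> sub_le n n' -> sub_le (sub_imp m n) (sub_imp m' n').
Proof.
move=> /sub_leP mm nn; apply/sub_impP; apply: sub_le_trans nn.
apply: sub_le_trans ((sub_impP (sub_imp m n) m n).1 (sub_le_refl _)).
by apply/sub_leP => d h /belongs_meet[hi /mm hm]; apply/belongs_meet.
Qed.

(** Implication is universal quantification along a monomorphism, hence the
    Beck-Chevalley condition applies. *)
Lemma sub_pb_imp (a b : C) (f : hom a b) (m n : sub b) (m' n' : sub a) :
  sub_eq m' (pb f m) -> sub_eq n' (pb f n) ->
  sub_eq (sub_imp m' n') (pb f (sub_imp m n)).
Proof.
move=> [m1 m2] [n1 n2].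
have sq := pbP (reg_pb C) f (sarr m); have [fm _] := sq.
apply: sub_eq_trans (sub_all_pb _ sq).
apply: (@sub_eq_trans _ _ _ (sub_imp (pb f m) (pb f n))).
  by split; apply: sub_imp_le.
have [le ge] := sub_pb_comp (reg_pb C) (sarr (pb f m)) f n.
have [le' ge'] := sub_pb_comp (reg_pb C) (pb2 (reg_pb C) f (sarr m)) (sarr m) n.
rewrite -fm in le' ge'.
by split; apply: sub_all_le; [apply: sub_le_trans le ge'|apply: sub_le_trans le' ge].
Qed.

End Stability.

(** * Variables and substitution *)

(** Case analysis on an index into a non-empty list, which plain case analysis
    does not offer because the list is an index of [member]. *)
Lemma member_case (T : Type) (r : T) (l : seq T)
    (Q : forall s, member (r :: l) s -> Prop) :
  Q r (mhead r l) -> (forall s (i : member l s), Q s (mtail r i)) ->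
  forall s i, Q s i.
Proof.
move=> Q0 Q1 s i; move: Q Q0 Q1.
refine (match i in member l' s' return
  match l' return member l' s' -> Prop with
  | [::] => fun _ => True
  | r :: l => fun i => forall Q : forall s, member (r :: l) s -> Prop,
      Q r (mhead r l) -> (forall s (i : member l s), Q s (mtail r i)) -> Q s' i
  end i with mhead _ _ => _ | mtail _ _ _ _ => _ end); auto.
Qed.

Lemma member_nil (T : Type) (s : T) (i : member [::] s) : False.
Proof. by inversion i. Qed.

Section Syntax.
Variable S : signature.
Implicit Types (D : seq (srt S)) (x y : var S) (G : seq (var S)).

Scheme term_mind := Induction for term Sort Prop
with terms_mind := Induction for terms Sort Prop.
Combined Scheme term_terms_ind from term_mind, terms_mind.

Lemma fpos_head x G (h : x \in x :: G) : fpos h = mhead x.1 [seq y.1 | y <- G].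
Proof. by rewrite /=; case: eqP => // e; rewrite (eq_axiomK e). Qed.

Lemma fpos_tail x y G (h : x \in y :: G) (h' : x \in G) :
  x <> y -> fpos h = mtail y.1 (fpos h').
Proof.
move=> xy /=; case: eqP => // ne.
by congr mtail; congr fpos; apply: bool_irrelevance.
Qed.

Lemma single_same D x (t : term D x.1) : single t x = t.
Proof. by rewrite /single; case: eqP => // e; rewrite (eq_axiomK e). Qed.

Lemma single_other D x y (t : term D x.1) : x <> y -> single t y = fvar D y.
Proof. by rewrite /single; case: eqP. Qed.

Lemma tFV_tshift D r s (t : term D s) : tFV (tshift r t) = tFV t.
Proof.
rewrite /tshift; move: s t; apply: (proj1 (term_terms_ind (D := D)
  (P := fun s t => tFV (tsubst _ _ t) = tFV t)
  (P0 := fun l ts => tsFV (tssubst (fun x => fvar (r :: D) x)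
     (fun _ i => bvar (mtail r i)) ts) = tsFV ts) _ _ _ _ _)) => //=.
by move=> s l t -> ts ->.
Qed.

Lemma notin_cup x (a b : seq (var S)) :
  (x \notin cup a b) = (x \notin a) && (x \notin b).
Proof. by rewrite mem_undup mem_cat negb_or. Qed.

Lemma notin_tssubst x D D' (sf : forall y, term D' y.1)
    (sb : forall s, member D s -> term D' s) l (ts : terms D l) :
  (forall y, x \notin tFV (sf y)) -> (forall s i, x \notin tFV (sb s i)) ->
  x \notin tsFV (tssubst sf sb ts).
Proof.
move=> xf xb; move: l ts; apply: (proj2 (term_terms_ind (D := D)
  (P := fun s t => x \notin tFV (tsubst sf sb t))
  (P0 := fun l ts => x \notin tsFV (tssubst sf sb ts)) _ _ _ _ _)) => //=.
by move=> s l t xt ts xts; rewrite notin_cup xt.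
Qed.

Lemma notin_fsubst x D (A : form D) D' (sf : forall y, term D' y.1)
    (sb : forall s, member D s -> term D' s) :
  (forall y, x \notin tFV (sf y)) -> (forall s i, x \notin tFV (sb s i)) ->
  x \notin FV (fsubst sf sb A).
Proof.
have shift D1 D2 r (tb : forall s, member D1 s -> term D2 s) :
    (forall s i, x \notin tFV (tb s i)) ->
    forall s (i : member (r :: D1) s), x \notin tFV (up tb i).
  by move=> xb; apply: member_case => //= s i; rewrite tFV_tshift.
elim: A D' sf sb => {D} [D|D|D r ts|D A IA B IB|D A IA B IB|D A IA B IB
  |D s A IA|D s A IA] D' sf sb xf xb //=;
  try by rewrite notin_cup IA ?IB.
- exact: notin_tssubst.
- by apply: IA => [y|]; [rewrite tFV_tshift|apply: shift].
- by apply: IA => [y|]; [rewrite tFV_tshift|apply: shift].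
Qed.

Lemma notin_abstract x (A : ltype S) : x \notin FV (abstract x A).
Proof.
apply: notin_fsubst => // y; have [<-|xy] := x =P y.
  by rewrite single_same.
by rewrite single_other //= inE; apply/eqP.
Qed.

Lemma tssubst_id D (sf : forall y, term D y.1)
    (sb : forall s, member D s -> term D s) l (ts : terms D l) :
  {in tsFV ts, forall y, sf y = fvar D y} -> (forall s i, sb s i = bvar i) ->
  tssubst sf sb ts = ts.
Proof.
move=> ef eb; move: l ts ef; apply: (proj2 (term_terms_ind (D := D)
  (P := fun s t => {in tFV t, forall y, sf y = fvar D y} ->
     tsubst sf sb t = t)
  (P0 := fun l ts => {in tsFV ts, forall y, sf y = fvar D y} ->
     tssubst sf sb ts = ts) _ _ _ _ _)) => //=.
- by move=> y ef; rewrite ef ?inE.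
- by move=> f ts IH ef; rewrite IH.
- move=> s l t It ts Its ef; rewrite It ?Its // => y yt; apply: ef;
    by rewrite mem_undup mem_cat yt ?orbT.
Qed.

Lemma fsubst_id D (A : form D) (sf : forall y, term D y.1)
    (sb : forall s, member D s -> term D s) :
  {in FV A, forall y, sf y = fvar D y} -> (forall s i, sb s i = bvar i) ->
  fsubst sf sb A = A.
Proof.
have shift D1 r (tb : forall s, member D1 s -> term D1 s) :
    (forall s i, tb s i = bvar i) ->
    forall s (i : member (r :: D1) s), up tb i = bvar i.
  by move=> eb; apply: member_case => //= s i; rewrite eb.
elim: A sf sb => {D} [D|D|D r ts|D A IA B IB|D A IA B IB|D A IA B IB
  |D s A IA|D s A IA] sf sb ef eb //=;
  try by rewrite IA ?IB // => y yA; apply: ef; rewrite mem_undup mem_cat yA ?orbT.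
- by rewrite tssubst_id.
- by rewrite IA // => [y yA|]; [rewrite ef|apply: shift].
- by rewrite IA // => [y yA|]; [rewrite ef|apply: shift].
Qed.

Lemma subst_id x (t : lterm S x.1) (A : ltype S) :
  x \notin FV A -> subst t A = A.
Proof.
move=> xA; apply: fsubst_id => // y yA; apply: single_other => xy.
by rewrite xy yA in xA.
Qed.

Lemma subst_var x (A : ltype S) : subst (fvar [::] x) A = A.
Proof.
apply: fsubst_id => // y _; have [<-|xy] := x =P y.
  by rewrite single_same.
exact: single_other.
Qed.

End Syntax.

(** * Interpretation of substitution *)

Lemma pairing_comp (C : category) (P : finite_products C) (a b c d : C)
    (f : hom c a) (g : hom c b) (h : hom d c) :
  pairing P f g ∘ h = pairing P (f ∘ h) (g ∘ h).
Proof. by rewrite [LHS]pair_uniq !compA pr1_pair pr2_pair. Qed.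

Lemma pr2_prod_map (C : category) (P : finite_products C) (a b c d : C)
    (f : hom a c) (g : hom b d) :
  pr2 P c d ∘ prod_map P f g = g ∘ pr2 P a b.
Proof. exact: pr2_pair. Qed.

Lemma prod_map_pullback (C : category) (P : finite_products C) (m a b : C)
    (f : hom a b) :
  is_pullback f (pr2 P m b) (pr2 P m a) (prod_map P (idm m) f).
Proof.
split=> [|d h k hk]; first by rewrite pr2_prod_map.
exists (pairing P (pr1 P m b ∘ k) h); split.
  rewrite pr2_pair pairing_comp comp1m -!compA pr1_pair pr2_pair hk.
  by rewrite -pair_uniq.
move=> u [<- <-]; rewrite [RHS]pair_uniq; congr pairing.
by rewrite compA pr1_pair comp1m.
Qed.

Section Interpretation.
Variables (S : signature) (C : heyting_category) (M : hstructure S C).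
Implicit Types (D : seq (srt S)) (x y : var S) (G V : seq (var S)).
Notation P := (reg_prod C).
Notation pb := (sub_pb (reg_pb C)).

(** The arrow sigma is the semantic counterpart of the substitution given by
    sf and sb. Only the named variables in V are constrained, so that the
    projection that discards a fresh variable x in front of the context realizes
    the identity even if x occurs, shadowed, further down. *)
Definition realizes V D D' G G' (sf : forall x, term D' x.1)
    (sb : forall s, member D s -> term D' s)
    (sigma : hom (ctx M D' G') (ctx M D G)) : Prop :=
  (forall x (xG : x \in G), x \in V ->
     exists h : {subset tFV (sf x) <= G'},
       tinterp M h = lproj P M (mskip D (fpos xG)) ∘ sigma) /\
  (forall s (i : member D s),
     exists h : {subset tFV (sb s i) <= G'},
       tinterp M h = lproj P M (bpos _ i) ∘ sigma).

Lemma term_substitution V D D' G G' (sf : forall x, term D' x.1)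
    (sb : forall s, member D s -> term D' s) sigma :
  realizes (G := G) (G' := G') V sf sb sigma ->
  (forall s (t : term D s) (h : {subset tFV t <= G})
     (h' : {subset tFV (tsubst sf sb t) <= G'}),
     {subset tFV t <= V} -> tinterp M h' = tinterp M h ∘ sigma) /\
  (forall l (ts : terms D l) (h : {subset tsFV ts <= G})
     (h' : {subset tsFV (tssubst sf sb ts) <= G'}),
     {subset tsFV ts <= V} -> tsinterp M h' = tsinterp M h ∘ sigma).
Proof.
move=> [rf rb]; apply: term_terms_ind => /=.
- move=> x h h' xV; have [|k <-] := rf x (h x (mem_head x [::])).
    exact/xV/mem_head.
  by rewrite (proof_irrelevance _ h' k).
- by move=> s i h h' _; have [k <-] := rb s i; rewrite (proof_irrelevance _ h' k).
- by move=> f ts IH h h' V_ts; rewrite (IH h) // compA.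
- by move=> h h' _; rewrite [RHS]bang_uniq.
- move=> s l t It ts Its h h' V_ts; rewrite pairing_comp.
  by rewrite (It (cup_subl h)) ?(Its (cup_subr h)) // => x xt; apply: V_ts;
    rewrite mem_undup mem_cat xt ?orbT.
Qed.

Lemma realizes_tshift V D G r :
  realizes V (fun x => fvar (r :: D) x) (fun _ i => bvar (mtail r i))
    (pr2 P (M r) (ctx M D G)).
Proof.
split=> [x xG _|s i].
  have h : {subset tFV (fvar (r :: D) x) <= G} by move=> y; rewrite inE => /eqP->.
  exists h => /=; congr (lproj P M (mskip D (fpos _)) ∘ _).
  exact: bool_irrelevance.
by have h : {subset tFV (bvar (mtail r i)) <= G} by []; exists h.
Qed.

Lemma tinterp_tshift D G r s (t : term D s) (h : {subset tFV t <= G})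
    (h' : {subset tFV (tshift r t) <= G}) :
  tinterp M h' = tinterp M h ∘ pr2 P (M r) (ctx M D G).
Proof.
by have [subt _] := term_substitution (realizes_tshift (tFV t) D G r); apply: subt.
Qed.

Lemma realizes_up V D D' G G' (sf : forall x, term D' x.1)
    (sb : forall s, member D s -> term D' s) sigma r :
  realizes (G := G) (G' := G') V sf sb sigma ->
  realizes (D := r :: D) (D' := r :: D') V (fun x => tshift r (sf x)) (up sb)
    (prod_map P (idm (M r)) sigma).
Proof.
have shift s (t : term D' s) (f : hom (ctx M D G) (M s)) :
    (exists h : {subset tFV t <= G'}, tinterp M h = f ∘ sigma) ->
    exists h : {subset tFV (tshift r t) <= G'},
      tinterp M h = f ∘ pr2 P (M r) (ctx M D G) ∘ prod_map P (idm (M r)) sigma.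
  move=> [h th]; have h' : {subset tFV (tshift r t) <= G'} by rewrite tFV_tshift.
  by exists h'; rewrite (tinterp_tshift h) th -!compA pr2_prod_map.
move=> [rf rb]; split=> [x xG xV|]; first exact: shift (rf x xG xV).
apply: member_case => [|s i]; last exact: shift (rb s i).
have h : {subset tFV (bvar (mhead r D')) <= G'} by [].
by exists h => /=; rewrite pr1_pair comp1m.
Qed.

(** Every connective is stable under pullback. Under a binder, sigma is
    replaced by its product with an identity, which is the pullback of sigma
    along the projection; there Beck-Chevalley applies. *)
Lemma formula_substitution V D D' G G' (A : form D) (sf : forall x, term D' x.1)
    (sb : forall s, member D s -> term D' s) sigma
    (h : {subset FV A <= G}) (h' : {subset FV (fsubst sf sb A) <= G'}) :
  realizes (G := G) (G' := G') V sf sb sigma -> {subset FV A <= V} ->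
  sub_eq (interp M h') (pb sigma (interp M h)).
Proof.
elim: A D' sf sb sigma h h' => {D} [D|D|D r ts|D A IA B IB|D A IA B IB
  |D A IA B IB|D s A IA|D s A IA] D' sf sb sigma h h' re AV /=.
- apply/sub_eqP => d k; rewrite belongs_pb.
  by split=> _; [exists (sigma ∘ k)|exists k]; rewrite /= comp1m.
- exact: sub_eq_sym (sub_pb_bot _).
- have [_ subts] := term_substitution re.
  rewrite (subts _ ts h) //; exact: sub_eq_sym (sub_pb_comp _ _ _ _).
- by apply: sub_pb_meet; [apply: IA re (cup_subl AV)|apply: IB re (cup_subr AV)].
- by apply: sub_pb_join_eq; [apply: IA re (cup_subl AV)|apply: IB re (cup_subr AV)].
- by apply: sub_pb_imp; [apply: IA re (cup_subl AV)|apply: IB re (cup_subr AV)].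
- apply: sub_eq_trans (sub_all_pb _ (prod_map_pullback P (M s) sigma)).
  have [le ge] := IA _ _ _ _ h h' (realizes_up s re) AV.
  by split; apply: sub_all_le.
- apply: sub_eq_trans (sub_ex_pb (prod_map_pullback P (M s) sigma) _).
  have [le ge] := IA _ _ _ _ h h' (realizes_up s re) AV.
  by split; apply: sub_ex_le.
Qed.

(** * Change of context *)

(** A change of context is a realization of the identity substitution. *)
Definition projects V G G' (sigma : hom (ctx M [::] G') (ctx M [::] G)) : Prop :=
  realizes V (fun x => fvar [::] x) (fun _ i => bvar i) sigma.

Lemma projectsP V G G' (sigma : hom (ctx M [::] G') (ctx M [::] G)) :
  (forall x (xG : x \in G), x \in V -> exists xG' : x \in G',
     lproj P M (fpos xG) ∘ sigma = lproj P M (fpos xG')) ->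
  projects V sigma.
Proof.
move=> pro; split=> [x xG xV|s i]; last by case: (member_nil i).
have [xG' e] := pro x xG xV.
have h : {subset tFV (fvar [::] x) <= G'} by move=> y; rewrite inE => /eqP->.
exists h => /=; rewrite e; congr (lproj P M (fpos _)).
exact: bool_irrelevance.
Qed.

Lemma interp_weaken V G G' (sigma : hom (ctx M [::] G') (ctx M [::] G))
    (A : ltype S) (h : {subset FV A <= G}) (h' : {subset FV A <= G'}) :
  projects V sigma -> {subset FV A <= V} ->
  sub_eq (interp M h') (pb sigma (interp M h)).
Proof.
move=> pro AV.
have := @formula_substitution V [::] [::] G G' A _ _ _ h _ pro AV.
by rewrite fsubst_id // => /(_ h').
Qed.

Lemma projection_exists G G' : {subset G <= G'} ->
  exists sigma : hom (ctx M [::] G') (ctx M [::] G), projects G sigma.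
Proof.
move=> GG'; suff [sigma e] : exists sigma : hom (ctx M [::] G') (ctx M [::] G),
    forall x (xG : x \in G) (xG' : x \in G'),
      lproj P M (fpos xG) ∘ sigma = lproj P M (fpos xG').
  exists sigma; apply: projectsP => x xG _.
  by exists (GG' x xG); apply: e.
elim: G GG' => [_|y G IH sub]; first by exists (bang P _).
have [x xG|sigma e] := IH; first by apply: sub; rewrite inE xG orbT.
exists (pairing P (lproj P M (fpos (sub y (mem_head y G)))) sigma) => x xG xG'.
have [xy|xy] := x =P y.
  move: xG xG'; rewrite xy {x xy} => yG yG'; rewrite fpos_head pr1_pair.
  by congr (lproj P M (fpos _)); apply: bool_irrelevance.
have xG1 : x \in G by move: xG; rewrite inE => /predU1P[].
by rewrite (fpos_tail _ xG1) //= -compA pr2_pair.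
Qed.

Lemma projects_pr2 x V G : x \notin V -> projects V (pr2 P (M x.1) (ctx M [::] G)
  : hom (ctx M [::] (x :: G)) (ctx M [::] G)).
Proof.
move=> xV; apply: projectsP => y yG yV.
have yxG : y \in x :: G by rewrite inE yG orbT.
exists yxG; rewrite (fpos_tail _ yG) // => yx.
by rewrite -yx yV in xV.
Qed.

(** Abstracting x moves it from the front of the named variables to the only
    bound position. Both contexts denote the same product, so the substitution
    involved is realized by an identity arrow. *)
Lemma interp_abstract x G (A : ltype S) (h : {subset FV A <= x :: G})
    (h' : {subset FV (abstract x A) <= G}) :
  sub_eq (interp M h' : sub (ctx M [::] (x :: G))) (interp M h).
Proof.
apply: sub_eq_trans (sub_pb_id (reg_pb C) _).
apply: (@formula_substitution (x :: G) [::] [:: x.1]) => //.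
split=> [y yxG _|s i]; last by case: (member_nil i).
have [xy|xy] := x =P y.
  move: yxG; rewrite -xy => xG; rewrite single_same.
  have k : {subset tFV (bvar (mhead x.1 [::])) <= G} by [].
  by exists k; rewrite compm1 [mskip _ _]fpos_head.
have yG : y \in G by move: yxG; rewrite inE => /predU1P[/esym|].
rewrite single_other //.
have k : {subset tFV (fvar [:: x.1] y) <= G} by move=> z; rewrite inE => /eqP->.
exists k; rewrite compm1 [mskip [::] _](fpos_tail _ yG); last by move/esym.
congr (lproj P M (mtail _ (fpos _))); exact: bool_irrelevance.
Qed.

(** Substituting t for x is realized by the graph of t, a section of the
    projection that discards x. *)
Lemma realizes_single x (t : lterm S x.1) G (k : {subset tFV t <= G}) :
  realizes (x :: G) (single t) (fun _ i => bvar i)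
    (pairing P (tinterp M k) (idm (ctx M [::] G))
      : hom (ctx M [::] G) (ctx M [::] (x :: G))).
Proof.
split=> [y yxG _|s i]; last by case: (member_nil i).
have [xy|xy] := x =P y.
  move: yxG; rewrite -xy => xG; rewrite single_same.
  by exists k; rewrite [mskip _ _]fpos_head pr1_pair.
have yG : y \in G by move: yxG; rewrite inE => /predU1P[/esym|].
rewrite single_other //.
have h : {subset tFV (fvar [::] y) <= G} by move=> z; rewrite inE => /eqP->.
exists h; rewrite [mskip _ _](fpos_tail _ yG); last by move/esym.
rewrite /= -compA pr2_pair compm1; congr (lproj P M (fpos _)).
exact: bool_irrelevance.
Qed.

End Interpretation.

(** * Entailment *)

Section Entailment.
Variables (S : signature) (C : heyting_category) (M : hstructure S C).
Hypothesis HM : well_supported M.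
Implicit Types (x : var S) (G : seq (var S)) (A B K : ltype S).
Notation P := (reg_prod C).
Notation pb := (sub_pb (reg_pb C)).
Notation "A ⊢ B" := (ld_le M A B) (at level 70).

(** The projection is the pullback of the regular epimorphism from M s to the
    terminal object. *)
Lemma regular_epi_pr2 (s : srt S) (b : C) : regular_epi (pr2 P (M s) b).
Proof.
apply: (@regular_epi_stable C _ _ _ _ (bang P (M s)) (bang P b) (pr1 P (M s) b));
  last exact: HM.
split=> [|d h k _]; first by rewrite [LHS]bang_uniq [RHS]bang_uniq.
exists (pairing P h k); split; first by rewrite pr1_pair pr2_pair.
by move=> u [<- <-]; rewrite -pair_uniq.
Qed.

Lemma sub_pb_pr2_reflect (s : srt S) (b : C) (m n : sub b) :
  sub_le (pb (pr2 P (M s) b) m) (pb (pr2 P (M s) b) n) -> sub_le m n.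
Proof.
move=> /sub_leP mn; apply/sub_leP => d h [v vh].
apply: (belongs_regular_epi (regular_epi_pr2 s d)).
rewrite -(pr2_prod_map P (idm (M s))); apply/belongs_pb/mn/belongs_pb.
by exists (v ∘ pr2 P (M s) d); rewrite pr2_prod_map compA vh.
Qed.

Definition entails G A B : Prop :=
  forall (hA : {subset FV A <= G}) (hB : {subset FV B <= G}),
    sub_le (interp M hA) (interp M hB).

Lemma entails_weaken G G' A B :
  {subset G <= G'} -> {subset FV A <= G} -> {subset FV B <= G} ->
  entails G A B -> entails G' A B.
Proof.
move=> GG' hA hB AB hA' hB'; have [sigma pro] := projection_exists M GG'.
have [le _] := interp_weaken hA hA' pro hA.
have [_ ge] := interp_weaken hB hB' pro hB.
by apply: sub_le_trans le _; apply: sub_le_trans ge; apply: sub_pb_le.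
Qed.

(** A variable that occurs in neither formula can be discarded since its sort
    is well-supported. *)
Lemma entails_strengthen x G A B :
  x \notin FV A -> x \notin FV B -> entails (x :: G) A B -> entails G A B.
Proof.
move=> xA xB AB hA hB; apply: (@sub_pb_pr2_reflect x.1).
have hA' : {subset FV A <= x :: G} by move=> y /hA; rewrite inE orbC => ->.
have hB' : {subset FV B <= x :: G} by move=> y /hB; rewrite inE orbC => ->.
have [_ ge] := interp_weaken hA hA' (projects_pr2 M G xA) (fun _ => id).
have [le _] := interp_weaken hB hB' (projects_pr2 M G xB) (fun _ => id).
by apply: sub_le_trans ge _; apply: sub_le_trans le; apply: AB.
Qed.

(** Entailment does not depend on the context: the excess variables of G are put
    in front of those of A and B, and discarded one at a time. *)
Lemma ld_leE G A B : {subset FV A <= G} -> {subset FV B <= G} ->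
  A ⊢ B <-> entails G A B.
Proof.
move=> hA hB; set G0 := cup (FV A) (FV B).
split=> [AB|AB].
  apply: (@entails_weaken G0); [|exact: sub_cupl|exact: sub_cupr|].
    by move=> y; rewrite mem_undup mem_cat => /orP[/hA|/hB].
  move=> kA kB; rewrite (proof_irrelevance _ kA (@sub_cupl _ _ _)).
  by rewrite (proof_irrelevance _ kB (@sub_cupr _ _ _)).
have {hA hB} AB : entails ([seq y <- G | y \notin G0] ++ G0) A B.
  apply: entails_weaken AB => // y yG.
  by rewrite mem_cat mem_filter yG andbT orNb.
suff: entails G0 A B by move=> AB0; apply: AB0.
have: {in [seq y <- G | y \notin G0], forall y, y \notin G0}.
  by move=> y; rewrite mem_filter => /andP[].
elim: [seq _ <- _ | _] AB => //= y G1 IH AB G1P.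
apply: IH => [|z zG1]; last by apply: G1P; rewrite inE zG1 orbT.
have := G1P y (mem_head _ _); rewrite notin_cup => /andP[yA yB].
exact: entails_strengthen AB.
Qed.

Ltac fv_subset :=
  let y := fresh "y" in
  move=> y; rewrite /= ?mem_undup ?inE ?mem_cat; repeat case: (y \in FV _);
  rewrite ?orbT.

Lemma ld_le_refl A : A ⊢ A.
Proof.
apply/(@ld_leE (FV A)) => // h h'.
by rewrite (proof_irrelevance _ h h'); apply: sub_le_refl.
Qed.

Lemma ld_le_trans A B K : A ⊢ B -> B ⊢ K -> A ⊢ K.
Proof.
set G := FV A ++ FV B ++ FV K.
have hA : {subset FV A <= G} by fv_subset.
have hB : {subset FV B <= G} by fv_subset.
have hK : {subset FV K <= G} by fv_subset.
move=> /(ld_leE hA hB) AB /(ld_leE hB hK) BK; apply/(ld_leE hA hK) => kA kK.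
exact: sub_le_trans (AB kA hB) (BK hB kK).
Qed.

Lemma ld_le_Top A : A ⊢ Top.
Proof.
apply/(@ld_leE (FV A)) => // h h'; apply/sub_leP => d k _.
by exists k; apply: comp1m.
Qed.

Lemma ld_le_Bot A : Bot ⊢ A.
Proof. by apply/(@ld_leE (FV A)) => // h h'; apply: sub_botP. Qed.

Lemma ld_le_And A B K : K ⊢ And A B <-> K ⊢ A /\ K ⊢ B.
Proof.
set G := FV A ++ FV B ++ FV K.
have hA : {subset FV A <= G} by fv_subset.
have hB : {subset FV B <= G} by fv_subset.
have hK : {subset FV K <= G} by fv_subset.
have hAB : {subset FV (And A B) <= G} by fv_subset.
rewrite (ld_leE hK hAB) (ld_leE hK hA) (ld_leE hK hB); split=> [KAB|[KA KB]].
  split=> kK k.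
    have /sub_meetP[+ _] := KAB kK hAB.
    by rewrite (proof_irrelevance _ k (cup_subl hAB)).
  have /sub_meetP[_] := KAB kK hAB.
  by rewrite (proof_irrelevance _ k (cup_subr hAB)).
by move=> kK kAB; apply/sub_meetP; split; [apply: KA|apply: KB].
Qed.

Lemma ld_le_Or A B K : Or A B ⊢ K <-> A ⊢ K /\ B ⊢ K.
Proof.
set G := FV A ++ FV B ++ FV K.
have hA : {subset FV A <= G} by fv_subset.
have hB : {subset FV B <= G} by fv_subset.
have hK : {subset FV K <= G} by fv_subset.
have hAB : {subset FV (Or A B) <= G} by fv_subset.
rewrite (ld_leE hAB hK) (ld_leE hA hK) (ld_leE hB hK); split=> [ABK|[AK BK]].
  split=> k kK.
    have /sub_joinP[+ _] := ABK hAB kK.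
    by rewrite (proof_irrelevance _ k (cup_subl hAB)).
  have /sub_joinP[_] := ABK hAB kK.
  by rewrite (proof_irrelevance _ k (cup_subr hAB)).
by move=> kAB kK; apply/sub_joinP; split; [apply: AK|apply: BK].
Qed.

Lemma ld_le_Imp A B K : K ⊢ Imp A B <-> And K A ⊢ B.
Proof.
set G := FV A ++ FV B ++ FV K.
have hB : {subset FV B <= G} by fv_subset.
have hK : {subset FV K <= G} by fv_subset.
have hKA : {subset FV (And K A) <= G} by fv_subset.
have hAB : {subset FV (Imp A B) <= G} by fv_subset.
rewrite (ld_leE hK hAB) (ld_leE hKA hB); split=> [KAB|KAB].
  move=> kKA kB; have /sub_impP := KAB (cup_subl kKA) hAB.
  rewrite (proof_irrelevance _ (cup_subl hAB) (cup_subr kKA)).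
  by rewrite (proof_irrelevance _ kB (cup_subr hAB)).
move=> kK kAB; apply/sub_impP; have := KAB hKA (cup_subr kAB).
rewrite /= (proof_irrelevance _ (cup_subl hKA) kK).
by rewrite (proof_irrelevance _ (cup_subr hKA) (cup_subl kAB)).
Qed.

(** The interpretation of B in a context with x in front is the pullback of its
    interpretation along the projection pi, since x is not free in B; hence this
    is the adjunction between pi^* and forall_pi. *)
Lemma ld_le_forall x A B : x \notin FV B -> B ⊢ forallv x A <-> B ⊢ A.
Proof.
move=> xB; set G := FV B ++ FV A ++ FV (forallv x A).
have hB : {subset FV B <= G} by fv_subset.
have hQ : {subset FV (forallv x A) <= G} by fv_subset.
have hxB : {subset FV B <= x :: G} by fv_subset.
have hxA : {subset FV A <= x :: G} by fv_subset.
rewrite (ld_leE hB hQ) (ld_leE hxB hxA).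
have [weak_le weak_ge] := interp_weaken hB hxB (projects_pr2 M G xB) (fun _ => id).
have [abs_le abs_ge] := interp_abstract M hxA hQ.
split=> [BQ k kA|BA k kQ].
  have /sub_allP := BQ hB hQ.
  rewrite (proof_irrelevance _ k hxB) (proof_irrelevance _ kA hxA) => BQ'.
  by apply: sub_le_trans abs_le; apply: sub_le_trans BQ'.
rewrite (proof_irrelevance _ k hB) (proof_irrelevance _ kQ hQ).
apply/sub_allP; apply: sub_le_trans abs_ge.
by apply: sub_le_trans weak_ge _; apply: BA.
Qed.

Lemma ld_le_exists x A B : x \notin FV B -> existsv x A ⊢ B <-> A ⊢ B.
Proof.
move=> xB; set G := FV B ++ FV A ++ FV (existsv x A).
have hB : {subset FV B <= G} by fv_subset.
have hQ : {subset FV (existsv x A) <= G} by fv_subset.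
have hxB : {subset FV B <= x :: G} by fv_subset.
have hxA : {subset FV A <= x :: G} by fv_subset.
rewrite (ld_leE hQ hB) (ld_leE hxA hxB).
have [weak_le weak_ge] := interp_weaken hB hxB (projects_pr2 M G xB) (fun _ => id).
have [abs_le abs_ge] := interp_abstract M hxA hQ.
split=> [QB kA k|AB kQ k].
  have /sub_exP := QB hQ hB.
  rewrite (proof_irrelevance _ k hxB) (proof_irrelevance _ kA hxA) => QB'.
  by apply: sub_le_trans abs_ge _; apply: sub_le_trans weak_ge.
rewrite (proof_irrelevance _ k hB) (proof_irrelevance _ kQ hQ).
apply/sub_exP; apply: sub_le_trans abs_le _.
by apply: sub_le_trans weak_le; apply: AB.
Qed.

Lemma ld_le_subst x (t : lterm S x.1) A B : A ⊢ B -> subst t A ⊢ subst t B.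
Proof.
set G := tFV t ++ FV (subst t A) ++ FV (subst t B) ++ FV A ++ FV B.
have ht : {subset tFV t <= G} by move=> y; rewrite mem_cat => ->.
have hA : {subset FV (subst t A) <= G} by fv_subset.
have hB : {subset FV (subst t B) <= G} by fv_subset.
have hxA : {subset FV A <= x :: G} by fv_subset.
have hxB : {subset FV B <= x :: G} by fv_subset.
move=> /(ld_leE hxA hxB) AB; apply/(ld_leE hA hB) => kA kB.
have [le _] := formula_substitution hxA kA (realizes_single M ht) hxA.
have [_ ge] := formula_substitution hxB kB (realizes_single M ht) hxB.
by apply: sub_le_trans le _; apply: sub_le_trans ge; apply: sub_pb_le.
Qed.

Lemma notin_forallv x A : x \notin FV (forallv x A).
Proof. exact: notin_abstract. Qed.

Lemma notin_existsv x A : x \notin FV (existsv x A).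
Proof. exact: notin_abstract. Qed.

Lemma notin_And x A B :
  (x \notin FV (And A B)) = (x \notin FV A) && (x \notin FV B).
Proof. exact: notin_cup. Qed.

Lemma notin_Imp x A B :
  (x \notin FV (Imp A B)) = (x \notin FV A) && (x \notin FV B).
Proof. exact: notin_cup. Qed.

(** By adjunction, the universal formula entails A itself; as x is not free in
    it, substituting t for x only affects A. *)
Lemma forall_elim x (t : lterm S x.1) A : forallv x A ⊢ subst t A.
Proof.
rewrite -(subst_id t (notin_forallv x A)); apply: ld_le_subst.
exact/(ld_le_forall _ (notin_forallv x A))/ld_le_refl.
Qed.

Lemma exists_intro x (t : lterm S x.1) A : subst t A ⊢ existsv x A.
Proof.
rewrite -(subst_id t (notin_existsv x A)); apply: ld_le_subst.
exact/(ld_le_exists _ (notin_existsv x A))/ld_le_refl.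
Qed.

Lemma And_elim A B : And A B ⊢ A /\ And A B ⊢ B.
Proof. exact/ld_le_And/ld_le_refl. Qed.

Lemma Or_intro A B : A ⊢ Or A B /\ B ⊢ Or A B.
Proof. exact/ld_le_Or/ld_le_refl. Qed.

Lemma Imp_elim A B : And (Imp A B) A ⊢ B.
Proof. exact/ld_le_Imp/ld_le_refl. Qed.

Lemma And_le A B A' B' : A ⊢ A' -> B ⊢ B' -> And A B ⊢ And A' B'.
Proof.
have [AB_A AB_B] := And_elim A B => AA BB.
by apply/ld_le_And; split; [apply: ld_le_trans AB_A AA|apply: ld_le_trans AB_B BB].
Qed.

Lemma Or_le A B A' B' : A ⊢ A' -> B ⊢ B' -> Or A B ⊢ Or A' B'.
Proof.
have [A_AB B_AB] := Or_intro A' B' => AA BB.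
by apply/ld_le_Or; split; [apply: ld_le_trans AA A_AB|apply: ld_le_trans BB B_AB].
Qed.

Lemma Imp_le A B A' B' : A' ⊢ A -> B ⊢ B' -> Imp A B ⊢ Imp A' B'.
Proof.
move=> AA BB; apply/ld_le_Imp; apply: ld_le_trans BB.
by apply: ld_le_trans (Imp_elim A B); apply: And_le => //; apply: ld_le_refl.
Qed.

Lemma And_comm A B : And A B ⊢ And B A.
Proof. by apply/ld_le_And; have [] := And_elim A B. Qed.

(** Conjunction with A is a left adjoint, so it preserves joins; the same
    argument applies to existential quantification below. *)
Lemma And_Or_distr A B K : And A (Or B K) ⊢ Or (And A B) (And A K).
Proof.
have [l r] := Or_intro (And A B) (And A K).
apply: ld_le_trans (And_comm _ _) _; apply/ld_le_Imp/ld_le_Or.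
by split; apply/ld_le_Imp; apply: ld_le_trans (And_comm _ _) _.
Qed.

Lemma exists_And x A B :
  x \notin FV A -> And A (existsv x B) ⊢ existsv x (And A B).
Proof.
move=> xA; apply: ld_le_trans (And_comm _ _) _; apply/ld_le_Imp/ld_le_exists.
  by rewrite notin_Imp xA notin_existsv.
apply/ld_le_Imp; apply: ld_le_trans (And_comm _ _) _.
exact/(ld_le_exists _ (notin_existsv x _))/ld_le_refl.
Qed.

Lemma And_exists x A B :
  x \notin FV A -> existsv x (And A B) ⊢ And A (existsv x B).
Proof.
move=> xA; apply/ld_le_exists; first by rewrite notin_And xA notin_existsv.
apply: And_le; first exact: ld_le_refl.
exact/(ld_le_exists _ (notin_existsv x _))/ld_le_refl.
Qed.

(** * Formulae as objects *)

(** An object is a context together with a class of equivalent subobjects of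
    its interpretation, and in a fixed context mutual entailment is equivalence
    of subobjects. *)
Lemma ldN_eqP A B : ldN M A = ldN M B <-> [/\ FV A = FV B, A ⊢ B & B ⊢ A].
Proof.
split=> [/(congr1 (@sval _ _)) /= e|[eFV AB BA]].
  have eFV : FV A = FV B := congr1 (@projT1 _ _) e.
  have hB : {subset FV B <= FV A} by rewrite eFV.
  have: forall h : {subset FV B <= projT1 (ld_denot M A)},
      projT2 (ld_denot M A) (interp M h).
    rewrite e => h; rewrite (proof_irrelevance _ h (fun _ => id)).
    exact: sub_eq_refl.
  move=> /(_ hB)[BA AB].
  split=> //; apply/(@ld_leE (FV A)) => // k k'.
    rewrite (proof_irrelevance _ k (fun _ => id)).
    by rewrite (proof_irrelevance _ k' hB).
  rewrite (proof_irrelevance _ k' (fun _ => id)).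
  by rewrite (proof_irrelevance _ k hB).
apply: hom_sig_eq => /=; rewrite /ld_denot.
suff gen G G' (h : {subset FV A <= G}) (h' : {subset FV B <= G'}) : G = G' ->
    existT (fun G => sub (ctx M [::] G) -> Prop) G (denot h) =
    existT _ G' (denot h') by exact: gen.
move=> eG; case: G' / eG h' => h'; congr existT.
apply: functional_extensionality => m; apply: propositional_extensionality.
have eAB : sub_eq (interp M h) (interp M h').
  by split; [apply: (ld_leE h h').1|apply: (ld_leE h' h).1].
by split=> e; apply: sub_eq_trans e _ => //; apply: sub_eq_sym.
Qed.

Lemma ld_homP A B : ld_hom (ldN M A) (ldN M B) <-> A ⊢ B.
Proof.
split=> [[A' [B' [/ldN_eqP[_ AA _] /ldN_eqP[_ _ BB] AB]]]|AB]; last by exists A, B.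
exact: ld_le_trans AA (ld_le_trans AB BB).
Qed.

(** The operations on objects need a formula to work on, hence a choice of
    representatives. *)
Definition ld_form (a : ld_obj M) : ltype S :=
  sval (constructive_indefinite_description _ (proj2_sig a)).

Lemma ld_formK a : ldN M (ld_form a) = a.
Proof.
apply: hom_sig_eq; rewrite /ld_form /=.
by case: constructive_indefinite_description => A /= ->.
Qed.

Lemma ld_homE a b : ld_hom a b <-> ld_form a ⊢ ld_form b.
Proof. by rewrite -ld_homP !ld_formK. Qed.

Lemma ldN_form A : [/\ FV (ld_form (ldN M A)) = FV A,
  ld_form (ldN M A) ⊢ A & A ⊢ ld_form (ldN M A)].
Proof. exact/ldN_eqP/ld_formK. Qed.

End Entailment.

(** * The category of formulae *)

Section LDCategory.
Variables (S : signature) (C : heyting_category) (M : hstructure S C).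
Hypothesis HM : well_supported M.
Implicit Types (x : var S) (A B : ltype S) (a b c : ld_obj M).
Notation "A ⊢ B" := (ld_le M A B) (at level 70).
Notation N := (ldN M).

Lemma ld_hom_from A b : ld_hom (N A) b <-> A ⊢ ld_form b.
Proof. by rewrite -(ld_homP HM) ld_formK. Qed.

Lemma ld_hom_to a B : ld_hom a (N B) <-> ld_form a ⊢ B.
Proof. by rewrite -(ld_homP HM) ld_formK. Qed.

Lemma ld_hom_refl a : ld_hom a a.
Proof. exact/(ld_homE HM)/ld_le_refl. Qed.

Lemma ld_hom_trans a b c : ld_hom b c -> ld_hom a b -> ld_hom a c.
Proof.
move=> /(ld_homE HM) bc /(ld_homE HM) ab.
by apply/(ld_homE HM); apply: ld_le_trans ab bc.
Qed.

Definition ld_category_on : category_on (@ld_hom S C M) :=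
  CategoryOn (idm_on := ld_hom_refl) (comp_on := ld_hom_trans)
    (fun _ _ _ => proof_irrelevance _ _ _) (fun _ _ _ => proof_irrelevance _ _ _)
    (fun _ _ _ _ _ _ _ => proof_irrelevance _ _ _).

Definition LD : category := Category ld_category_on.

Lemma LD_thin (a b : LD) (f g : hom a b) : f = g.
Proof. exact: (@proof_irrelevance (ld_hom a b)). Qed.

Lemma LD_iso (a b : LD) (f : hom a b) : ld_hom b a -> is_iso f.
Proof. by move=> g; exists g; split; apply: LD_thin. Qed.

Definition ld_and a b : ld_obj M := N (And (ld_form a) (ld_form b)).
Definition ld_or a b : ld_obj M := N (Or (ld_form a) (ld_form b)).
Definition ld_imp a b : ld_obj M := N (Imp (ld_form a) (ld_form b)).

Lemma ld_bang a : ld_hom a (N Top).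
Proof. exact/ld_hom_to/ld_le_Top. Qed.

Lemma ld_pr1 a b : ld_hom (ld_and a b) a.
Proof. by apply/ld_hom_from; case: (And_elim HM (ld_form a) (ld_form b)). Qed.

Lemma ld_pr2 a b : ld_hom (ld_and a b) b.
Proof. by apply/ld_hom_from; case: (And_elim HM (ld_form a) (ld_form b)). Qed.

Lemma ld_pairing c a b : ld_hom c a -> ld_hom c b -> ld_hom c (ld_and a b).
Proof.
by move=> /(ld_homE HM) ca /(ld_homE HM) cb; apply/ld_hom_to/(ld_le_And HM).
Qed.

Definition ld_products : finite_products LD :=
  @FiniteProducts LD (N Top) ld_bang (fun _ _ => LD_thin _ _)
    ld_and ld_pr1 ld_pr2 ld_pairing
    (fun _ _ _ _ _ => LD_thin _ _) (fun _ _ _ _ _ => LD_thin _ _)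
    (fun _ _ _ _ => LD_thin _ _).

Lemma ld_cobang a : ld_hom (N Bot) a.
Proof. exact/ld_hom_from/ld_le_Bot. Qed.

Lemma ld_in1 a b : ld_hom a (ld_or a b).
Proof. by apply/ld_hom_to; case: (Or_intro HM (ld_form a) (ld_form b)). Qed.

Lemma ld_in2 a b : ld_hom b (ld_or a b).
Proof. by apply/ld_hom_to; case: (Or_intro HM (ld_form a) (ld_form b)). Qed.

Lemma ld_copair c a b : ld_hom a c -> ld_hom b c -> ld_hom (ld_or a b) c.
Proof.
by move=> /(ld_homE HM) ac /(ld_homE HM) bc; apply/ld_hom_from/(ld_le_Or HM).
Qed.

Definition ld_coproducts : finite_coproducts LD :=
  @FiniteCoproducts LD (N Bot) ld_cobang (fun _ _ => LD_thin _ _)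
    ld_or ld_in1 ld_in2 ld_copair
    (fun _ _ _ _ _ => LD_thin _ _) (fun _ _ _ _ _ => LD_thin _ _)
    (fun _ _ _ _ => LD_thin _ _).

(** The operations do not depend on the choice of representatives, because the
    connectives are monotone and the free variables of a compound formula only
    depend on those of its components. *)
Lemma ldN_And A B : N (And A B) = ld_and (N A) (N B).
Proof.
have [eA A1 A2] := ldN_form HM A; have [eB B1 B2] := ldN_form HM B.
by apply/(ldN_eqP HM); split; [rewrite /= eA eB|apply: And_le|apply: And_le].
Qed.

Lemma ldN_Or A B : N (Or A B) = ld_or (N A) (N B).
Proof.
have [eA A1 A2] := ldN_form HM A; have [eB B1 B2] := ldN_form HM B.
by apply/(ldN_eqP HM); split; [rewrite /= eA eB|apply: Or_le|apply: Or_le].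
Qed.

Lemma ldN_Imp A B : N (Imp A B) = ld_imp (N A) (N B).
Proof.
have [eA A1 A2] := ldN_form HM A; have [eB B1 B2] := ldN_form HM B.
by apply/(ldN_eqP HM); split; [rewrite /= eA eB|apply: Imp_le|apply: Imp_le].
Qed.

Lemma ld_eval b a : ld_hom (ld_and (ld_imp a b) a) b.
Proof.
rewrite -{2}(ld_formK a) -ldN_And; apply/ld_hom_from.
exact: Imp_elim.
Qed.

Lemma ld_curry c b a : ld_hom (ld_and c a) b -> ld_hom c (ld_imp a b).
Proof. by move=> /ld_hom_from cab; apply/ld_hom_to/(ld_le_Imp HM). Qed.

Definition ld_exponentials : exponentials ld_products :=
  @Exponentials LD ld_products (fun b a => ld_imp a b) ld_eval ld_curry
    (fun _ _ _ _ => LD_thin _ _) (fun _ _ _ _ => LD_thin _ _).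

(** The variable x is itself a term, so the leg of a cone at x is the premise
    of the introduction rule for the universal quantifier. *)
Lemma ld_forall_terminal x A : exists2 c : forall_cat (C := LD) N x A,
  is_terminal c & qc_vertex c = N (forallv x A).
Proof.
have w : exists2 B, N (forallv x A) = N B & x \notin FV B.
  by exists (forallv x A) => //; apply: notin_forallv.
have leg (t : lterm S x.1) : ld_hom (N (forallv x A)) (N (subst t A)).
  by apply/(ld_homP HM); apply: forall_elim.
pose u := @QCone _ LD N x A (N (forallv x A)) w leg; exists u => // d.
have [B dB xB] := qc_form d.
have f : ld_hom (qc_vertex d) (N (forallv x A)).
  have := qc_leg d (fvar [::] x); rewrite subst_var dB => /(ld_homP HM) BA.
  exact/(ld_homP HM)/(ld_le_forall HM).
have fP : qcone_arrow (d := u) f.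
  by split=> [t|]; [apply: LD_thin|left].
exists (exist _ f fP) => g; apply: hom_sig_eq; exact: LD_thin.
Qed.

(** Dually, the leg of a co-cone at x is the premise of the elimination rule. *)
Lemma ld_exists_initial x A : exists2 c : exists_cat (C := LD) N x A,
  is_initial c & qcc_vertex c = N (existsv x A).
Proof.
have w : exists2 B, N (existsv x A) = N B & x \notin FV B.
  by exists (existsv x A) => //; apply: notin_existsv.
have leg (t : lterm S x.1) : ld_hom (N (subst t A)) (N (existsv x A)).
  by apply/(ld_homP HM); apply: exists_intro.
pose u := @QCocone _ LD N x A (N (existsv x A)) w leg; exists u => // d.
have [B dB xB] := qcc_form d.
have f : ld_hom (N (existsv x A)) (qcc_vertex d).
  have := qcc_leg d (fvar [::] x); rewrite subst_var dB => /(ld_homP HM) AB.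
  exact/(ld_homP HM)/(ld_le_exists HM).
have fP : qcocone_arrow (c := u) f.
  by split=> [t|]; [apply: LD_thin|left].
exists (exist _ f fP) => g; apply: hom_sig_eq; exact: LD_thin.
Qed.

Lemma ld_exists_distributes x A B :
  x \notin FV A -> exists_distr (C := LD) N ld_products x A B.
Proof.
move=> xA c d _ cE _ dE.
have vE : ld_and (N A) (qcc_vertex d) = N (And A (existsv x B)).
  by rewrite dE ldN_And.
have w : exists2 E, ld_and (N A) (qcc_vertex d) = N E & x \notin FV E.
  by exists (And A (existsv x B)); rewrite // notin_And xA notin_existsv.
have e (t : lterm S x.1) : N (subst t (And A B)) = ld_and (N A) (N (subst t B)).
  by rewrite -ldN_And -{2}(subst_id t xA).
have f : ld_hom (qcc_vertex c) (ld_and (N A) (qcc_vertex d)).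
  by rewrite cE vE; apply/(ld_homP HM)/And_exists.
exists w, e; set v := (X in hom c X).
have fP : @qcocone_arrow _ LD N x (And A B) c v f.
  by split=> [t|]; [apply: LD_thin|left].
exists (exist _ f fP); apply: LD_iso.
by rewrite /= vE cE; apply/(ld_homP HM)/exists_And.
Qed.

Lemma ld_distributive (a b c : LD) :
  is_iso (distr_arrow ld_products ld_coproducts a b c).
Proof.
apply: LD_iso => /=.
rewrite -(ld_formK a) -(ld_formK b) -(ld_formK c) -!(ldN_And, ldN_Or).
exact/(ld_homP HM)/And_Or_distr.
Qed.

End LDCategory.

Theorem proposition8p13 (S : signature) (C : heyting_category)
    (M : hstructure S C) (HM : well_supported M) :
  exists D : category_on (@ld_hom S C M),
    logically_distributive (C := Category D) (@ldN S C M).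
Proof.
exists (ld_category_on HM).
exists (ld_products HM), (ld_coproducts HM), (ld_exponentials HM); split=> //.
- exact: ld_distributive.
- exact: ldN_And.
- exact: ldN_Or.
- exact: ldN_Imp.
- exact: ld_forall_terminal.
- exact: ld_exists_initial.
- exact: ld_exists_distributes.
Qed.
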